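(* Let $d\ge 2$ and let $\mu$ be a symmetric non-degenerate probability measure on the free group $\mathbf{F}_d$. Suppose $\Gamma$ is a proper quotient of $\mathbf{F}_d$. Then for any $\epsilon>0$ there exists a quotient group $\tilde\Gamma$ of $\mathbf{F}_d$ such that $\mathbf{F}_d\twoheadrightarrow\tilde\Gamma\twoheadrightarrow\Gamma$ and $$\rho(\Gamma,\mu)-\epsilon<\rho(\tilde\Gamma,\mu)<\rho(\Gamma,\mu).$$
   Context: A probability measure $\mu$ on a group $G$ is symmetric if $\mu(g)=\mu(g^{-1})$ for all $g$, and non-degenerate if its support generates $G$ as a semigroup. A quotient of $\mathbf{F}_d$ is a group $\Gamma=\mathbf{F}_d/N$ with $N$ normal, together with the quotient map; it is proper if $N\neq\{id\}$. The notation $\mathbf{F}_d\twoheadrightarrow\tilde\Gamma\twoheadrightarrow\Gamma$ means that the quotient map $\mathbf{F}_d\to\Gamma$ factors through the quotient map $\mathbf{F}_d\to\tilde\Gamma$. For a quotient $\Gamma$ of $\mathbf{F}_d$, write again $\mu$ for the pushforward of $\mu$ to $\Gamma$. The spectral radius is $$\rho(\Gamma,\mu)=\limsup_{n\to\infty}\mu^{(2n)}(id_\Gamma)^{\frac1{2n}},$$ where $\mu^{(m)}$ is the $m$-fold convolution of $\mu$ (on $\Gamma$) with itself. *)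

(* Defs.v *)
From HB Require Import structures.
From mathcomp Require Import all_boot all_order all_algebra.
From mathcomp Require Import all_classical all_reals all_analysis.

Set Implicit Arguments.
Unset Strict Implicit.
Unset Printing Implicit Defensive.

Import Order.TTheory GRing.Theory Num.Theory.

Local Open Scope classical_set_scope.
Local Open Scope group_scope.

(* The free group on 'I_d: reduced words in the letters (i, false) = x_i and
   (i, true) = x_i^-1, multiplied by concatenation followed by reduction. *)
Section FreeGroup.
Variable d : nat.

Definition letter : Type := ('I_d * bool)%type.
Implicit Types (a b : letter) (w : seq letter).

Definition letter_inv a : letter := (a.1, ~~ a.2).

Definition reduced w : bool := sorted (fun a b => b != letter_inv a) w.

Record free_group : Type :=
  FreeGroup { word :> seq letter; reduced_word : reduced word }.

HB.instance Definition _ := [isSub for word].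
HB.instance Definition _ := [Countable of free_group by <:].

(* The reduced form of the product of the letter a with the reduced word w. *)
Definition push a w : seq letter :=
  if w is b :: w' then if b == letter_inv a then w' else a :: w else [:: a].

Lemma letter_invK : involutive letter_inv.
Proof. by case=> i b; rewrite /letter_inv /= negbK. Qed.

Lemma push_reduced a w : reduced w -> reduced (push a w).
Proof.
case: w => [//|b w] /=; case: ifP => [_|nab] bw; first exact: path_sorted bw.
by rewrite /= nab bw.
Qed.

Lemma foldr_push_reduced u w : reduced w -> reduced (foldr push w u).
Proof. by move=> rw; elim: u => //= a u /push_reduced; exact. Qed.

Lemma push_inv a w : reduced w -> push a (push (letter_inv a) w) = w.
Proof.
case: w => [|b w] /=; first by rewrite eqxx.
rewrite letter_invK; case: eqP => [-> | _] bw /=; last by rewrite eqxx.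
case: w bw => [//|c w] /= /andP[ca _].
by rewrite (negbTE ca).
Qed.

Lemma push_foldr a u w : reduced w ->
  foldr push w (push a u) = push a (foldr push w u).
Proof.
case: u => [//|b u] /= rw; case: eqP => [->|//].
by rewrite push_inv// foldr_push_reduced.
Qed.

Lemma foldr_push1 u : reduced u -> foldr push [::] u = u.
Proof.
elim: u => //= a u IHu au; rewrite (IHu (path_sorted au)).
by case: u {IHu} au => [//|b u] /= /andP[/negbTE ->].
Qed.

Definition free_mul (u v : free_group) : free_group :=
  FreeGroup (foldr_push_reduced u (reduced_word v)).

Definition free_one : free_group := @FreeGroup [::] isT.

Lemma inv_reduced w : reduced w -> reduced (rev (map letter_inv w)).
Proof.
rewrite /reduced rev_sorted sorted_map; apply: sub_sorted => a b /=.
by rewrite letter_invK eq_sym.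
Qed.

Definition free_inv (u : free_group) : free_group :=
  FreeGroup (inv_reduced (reduced_word u)).

Lemma free_mulA : associative free_mul.
Proof.
move=> u v w; apply: val_inj => /=; elim: (word u) => //= a s ->.
by rewrite push_foldr// (reduced_word w).
Qed.

Lemma free_mul1 : left_id free_one free_mul.
Proof. by move=> u; apply: val_inj. Qed.

Lemma free_mulr1 : right_id free_one free_mul.
Proof. by move=> u; apply: val_inj; rewrite /= foldr_push1 ?reduced_word. Qed.

Lemma foldr_push_rev_inv s w : reduced w ->
  foldr push (foldr push w s) (rev (map letter_inv s)) = w.
Proof.
move=> rw; elim: s => //= a s IHs; rewrite rev_cons -cats1 foldr_cat /=.
have := @push_inv (letter_inv a) (foldr push w s).
by rewrite letter_invK => ->//; rewrite foldr_push_reduced.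
Qed.

Lemma free_mulV : left_inverse free_one free_inv free_mul.
Proof.
move=> u; apply: val_inj => /=.
rewrite -[X in foldr _ X _]foldr_push1 ?reduced_word//.
exact: foldr_push_rev_inv.
Qed.

Lemma free_invK : involutive free_inv.
Proof.
move=> u; apply: val_inj => /=.
by rewrite map_rev revK -map_comp (eq_map letter_invK) map_id.
Qed.

Lemma free_mulrV : right_inverse free_one free_inv free_mul.
Proof. by move=> u; rewrite -{1}[u]free_invK free_mulV. Qed.

HB.instance Definition _ := isGroup.Build free_group
  free_mulA free_mul1 free_mulr1 free_mulV free_mulrV.

HB.instance Definition _ := isPointed.Build free_group (1 : free_group).
HB.instance Definition _ := @isMeasurable.Build default_measure_display
  free_group discrete_measurable discrete_measurable0
  discrete_measurableC discrete_measurableU.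

End FreeGroup.

Record normal_subgroup (G : groupType) : Type := NormalSubgroup {
  nsubgroup : set G;
  nsubgroup1 : nsubgroup 1;
  nsubgroupM : forall x y, nsubgroup x -> nsubgroup y -> nsubgroup (x * y);
  nsubgroupV : forall x, nsubgroup x -> nsubgroup x^-1;
  nsubgroupJ : forall x y, nsubgroup x -> nsubgroup (x ^ y)
}.

Section Quotient.
Variables (G : groupType) (N : normal_subgroup G).
Implicit Types x y z : G.

Definition coset_eq x y : bool := `[< nsubgroup N (x^-1 * y) >].

Lemma coset_eq_refl : reflexive coset_eq.
Proof. by move=> x; apply/asboolP; rewrite mulVg; exact: nsubgroup1. Qed.

Lemma coset_eq_sym : symmetric coset_eq.
Proof.
suff H x y : coset_eq x y -> coset_eq y x by move=> x y; apply/idP/idP; exact: H.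
by move=> /asboolP/nsubgroupV; rewrite invgM invgK => ?; apply/asboolP.
Qed.

Lemma coset_eq_trans : transitive coset_eq.
Proof.
move=> y x z /asboolP xy /asboolP yz; apply/asboolP.
by have := nsubgroupM xy yz; rewrite -mulgA mulVKg.
Qed.

Canonical coset_eq_equiv :=
  EquivRel coset_eq coset_eq_refl coset_eq_sym coset_eq_trans.

Definition quotient_group : Type := {eq_quot coset_eq}%qT.
HB.instance Definition _ := Choice.on quotient_group.
HB.instance Definition _ := EqQuotient.on quotient_group.

Definition quotient_map : G -> quotient_group := \pi_quotient_group%qT.

Lemma quotient_mapP x y : quotient_map x = quotient_map y <-> nsubgroup N (x^-1 * y).
Proof.
split=> [/eqP|Nxy]; first by rewrite eqmodE => /asboolP.
by apply/eqP; rewrite eqmodE; apply/asboolP.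
Qed.

Definition quotient_mul (p q : quotient_group) : quotient_group :=
  quotient_map (repr p * repr q).
Definition quotient_one : quotient_group := quotient_map 1.
Definition quotient_inv (p : quotient_group) : quotient_group :=
  quotient_map (repr p)^-1.

Lemma repr_quotient_map x : nsubgroup N (x^-1 * repr (quotient_map x)).
Proof. by apply/quotient_mapP; rewrite /quotient_map reprK. Qed.

Lemma quotient_mapM x y :
  quotient_map (x * y) = quotient_mul (quotient_map x) (quotient_map y).
Proof.
apply/quotient_mapP; rewrite invgM.
have /(nsubgroupJ (repr (quotient_map y))) Nx := repr_quotient_map x.
have := nsubgroupM (repr_quotient_map y) Nx.
by rewrite /conjg !mulgA mulgK.
Qed.

Lemma quotient_mapV x : quotient_map x^-1 = quotient_inv (quotient_map x).
Proof.
apply/quotient_mapP; rewrite invgK.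
have /nsubgroupV/(nsubgroupJ x^-1) := repr_quotient_map x.
by rewrite /conjg invgK invgM invgK !mulgA mulgK.
Qed.

Lemma quotient_mapK (p : quotient_group) : quotient_map (repr p) = p.
Proof. exact: reprK. Qed.

Lemma quotient_mulA : associative quotient_mul.
Proof.
move=> p q r; rewrite -(quotient_mapK p) -(quotient_mapK q) -(quotient_mapK r).
by rewrite -!quotient_mapM mulgA.
Qed.

Lemma quotient_mul1 : left_id quotient_one quotient_mul.
Proof. by move=> p; rewrite -(quotient_mapK p) -quotient_mapM mul1g. Qed.

Lemma quotient_mulr1 : right_id quotient_one quotient_mul.
Proof. by move=> p; rewrite -(quotient_mapK p) -quotient_mapM mulg1. Qed.

Lemma quotient_mulV : left_inverse quotient_one quotient_inv quotient_mul.
Proof.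
by move=> p; rewrite -(quotient_mapK p) -quotient_mapV -quotient_mapM mulVg.
Qed.

Lemma quotient_mulrV : right_inverse quotient_one quotient_inv quotient_mul.
Proof.
by move=> p; rewrite -(quotient_mapK p) -quotient_mapV -quotient_mapM mulgV.
Qed.

HB.instance Definition _ := isGroup.Build quotient_group
  quotient_mulA quotient_mul1 quotient_mulr1 quotient_mulV quotient_mulrV.

HB.instance Definition _ := isMultiplicative.Build G quotient_group
  quotient_map quotient_mapM.

HB.instance Definition _ := isPointed.Build quotient_group (1 : quotient_group).
HB.instance Definition _ := @isMeasurable.Build default_measure_display
  quotient_group discrete_measurable discrete_measurable0
  discrete_measurableC discrete_measurableU.

End Quotient.

Definition proper_quotient (G : groupType) (N : normal_subgroup G) : Prop :=
  nsubgroup N <> [set 1].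

(* G ->> G / M ->> G / N *)
Definition quotient_factors (G : groupType) (M N : normal_subgroup G) : Prop :=
  exists f : {multiplicative quotient_group M -> quotient_group N},
    quotient_map N = f \o quotient_map M.

Section RandomWalk.
Variables (R : realType) (G : groupType).
Implicit Types (mu : set G -> \bar R) (p q : G -> \bar R).
Local Open Scope ereal_scope.

Definition symmetric_measure mu : Prop :=
  forall g : G, mu [set g] = mu [set g^-1%g].

Definition measure_support mu : set G := [set g | 0 < mu [set g]].

Definition mul_closed (A : set G) : Prop :=
  forall x y, A x -> A y -> A (x * y)%g.

Definition generates_semigroup (S : set G) : Prop :=
  smallest mul_closed S = [set: G].

Definition non_degenerate mu : Prop := generates_semigroup (measure_support mu).

(* Measures on a countable discrete group are convolved through their mass
   functions g |-> mu {g}. *)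
Definition convolution p q : G -> \bar R :=
  fun g => esum [set: G] (fun h => p h * q (h^-1 * g)%g).

Definition convolution_power mu (m : nat) : G -> \bar R :=
  iter m (convolution (fun g => mu [set g])) (fun g => (g == 1%g)%:R%:E).

(* The term n = 0 is a junk value, irrelevant to the limit superior. *)
Definition spectral_radius mu : \bar R :=
  limn_esup (fun n : nat =>
    poweR (convolution_power mu (2 * n) 1%g) ((2 * n)%:R^-1)%R).

End RandomWalk.

Definition quotient_spectral_radius (R : realType) (d : nat)
    (N : normal_subgroup (free_group d)) (mu : set (free_group d) -> \bar R) :
    \bar R :=
  spectral_radius (pushforward mu (quotient_map N)).

(* Main.v *)
From HB Require Import structures.
Require Import Defs.
From mathcomp Require Import all_boot all_order all_algebra.
From mathcomp Require Import all_classical all_reals all_analysis.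
From mathcomp Require Import zify ring lra.

(** Write F for the free group and rho(N) for the spectral radius of F / N.

    The normal subgroup M is found inside P, the intersection of N with the
    kernel of the total exponent sum (the height).  Since N / P is abelian,
    rho(P) = rho(N); since F / P maps onto the integers, its Cayley graph is
    infinite, which leaves room to place two edges far apart; and P is not
    trivial because the centre of F is trivial ([height_kernel]).

    Lower bound.  Let S be a finite set of elements of a group that commute
    with one another.  Products of j elements of S take at most
    (j + 1)^|S| values, so by the Cauchy-Schwarz inequality the walk with
    steps in S returns to the identity with a probability that decays no
    faster than the power of the mass of S, up to a polynomial factor:
    [radius_commuting].  Applied to F / P with S in N this gives
    rho(N) <= rho(P).  It also shows that rho(M) > rho(P) - eps as soon as M
    contains the commutators of a suitable finite set S in P, namely one that
    carries most of the mass that a long power of mu gives to P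
    ([finite_subset_mass]).

    Upper bound.  Suppose that P / M contains a and b that act on F / M with a
    set E such that E and the a-preimage of E cover everything while E and its
    first two b-preimages are disjoint.  Then no unit vector of l^2(F / M) is
    almost invariant under both a and b ([paradoxical_gap]).  A Green function
    of F / P is a positive superharmonic function on F / P for any eigenvalue
    lam > rho(P) ([exists_superharmonic]); pulled back to F / M it serves as
    weight in a Schur test ([schur_test]), which bounds the walk on F / M by
    powers of lam.  The weight is constant along a and b, so in these two
    directions the test loses exactly the squared displacement
    |a f - f|^2 + |b f - f|^2, which is at least a fixed multiple of |f|^2.
    Hence rho(M) < rho(P): [radius_strict].

    Construction of M ([exists_intermediate]).  In the Cayley graph of F / P,
    give two edges labels b1 and b2, two of the generators of a free group Q,
    and all other edges the trivial label.  Multiplying labels along paths gives an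
    action of F on (F / P) x Q; let M be its kernel.  If the edges are farther
    apart than any word of S reaches, then from any starting point all the
    loops in S meet only one of the two edges, their labels commute, and so S
    commutes modulo M.  On the other hand a shortest nontrivial loop p crosses its
    first edge exactly once; if that edge and its translate by h are the labelled
    ones, then p has label b1 and the loop h p h^-1 has label b2, and ping-pong
    in Q supplies the set E. *)

Set Implicit Arguments.
Unset Strict Implicit.
Unset Printing Implicit Defensive.
Import Order.TTheory GRing.Theory Num.Theory.
Local Open Scope classical_set_scope.
Local Open Scope group_scope.

(** * Sums of nonnegative families and convolution powers *)

Section Sums.
Variable R : realType.
Local Open Scope ring_scope.
Local Open Scope ereal_scope.

Lemma fsum_le_esum (T : choiceType) (I X : set T) (a : T -> \bar R) :
  finite_set X -> X `<=` I -> \sum_(x \in X) a x <= \esum_(x in I) a x.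
Proof. by move=> fX XI; apply: esum_ge; exists X. Qed.

Lemma esum_ge1 (T : choiceType) (I : set T) (a : T -> \bar R) t :
  (forall x, 0 <= a x) -> I t -> a t <= \esum_(x in I) a x.
Proof.
move=> a0 It; apply: esum_ge; exists [set t]; last by rewrite fsbig_set1.
by split => // x ->.
Qed.

(** The finite sums only give one inequality; the other one follows by applying
    it to the scalar c^-1, and an infinite scalar is treated apart. *)
Lemma esumZl (T : choiceType) (I : set T) (a : T -> \bar R) (c : \bar R) :
  0 <= c -> (forall x, 0 <= a x) ->
  \esum_(x in I) (c * a x) = c * \esum_(x in I) a x.
Proof.
move=> c0 a0.
have s0 : 0 <= \esum_(x in I) a x by exact: esum_ge0.
have le_c (e : \bar R) (b : T -> \bar R) : 0 <= e -> (forall x, 0 <= b x) ->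
    \esum_(x in I) (e * b x) <= e * \esum_(x in I) b x.
  move=> e0 b0; apply: ge_ereal_sup => _ [X [finX XI] <-].
  rewrite -ge0_mule_fsumr; last by move=> x; exact: b0.
  by rewrite lee_wpmul2l// fsum_le_esum.
apply/eqP; rewrite eq_le le_c//=.
case: c c0 => [c| |//] c0; last first.
  have [s00|sN0] := eqVneq (\esum_(x in I) a x) 0.
    by rewrite s00 mule0 esum_ge0// => x _; rewrite mule_ge0.
  have : 0 < \esum_(x in I) a x by rewrite lt0e sN0 s0.
  move=> /ereal_sup_gt[_ [X [finX XI] <-]] sX.
  rewrite gt0_mulye ?lt0e ?sN0 ?s0//.
  rewrite -[leLHS](gt0_mulye sX) ge0_mule_fsumr//.
  exact: fsum_le_esum.
have [->|cN0] := eqVneq c 0%R.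
  by rewrite mul0e esum_ge0// => x _; rewrite mul0e.
have c_gt0 : (0 < c)%R by rewrite lt0r cN0 -lee_fin.
have := le_c (c^-1)%:E (fun x => c%:E * a x).
rewrite lee_fin invr_ge0 (ltW c_gt0) => /(_ isT) /(_ (fun x => mule_ge0 c0 (a0 x))).
have -> : \esum_(x in I) ((c^-1)%:E * (c%:E * a x)) = \esum_(x in I) a x.
  by apply: eq_esum => x _; rewrite muleA -EFinM mulVf// mul1e.
move=> /(lee_wpmul2l (ltW c_gt0 : (0%R)%:E <= c%:E)).
by rewrite muleA -EFinM mulfV// mul1e.
Qed.

Lemma esumZr (T : choiceType) (I : set T) (a : T -> \bar R) (c : \bar R) :
  0 <= c -> (forall x, 0 <= a x) ->
  \esum_(x in I) (a x * c) = (\esum_(x in I) a x) * c.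
Proof.
move=> c0 a0; rewrite muleC -esumZl//; apply: eq_esum => x _; exact: muleC.
Qed.

Lemma exchange_esum (T1 T2 : choiceType) (I : set T1) (J : set T2)
    (a : T1 -> T2 -> \bar R) : (forall x y, 0 <= a x y) ->
  \esum_(x in I) \esum_(y in J) a x y = \esum_(y in J) \esum_(x in I) a x y.
Proof.
move=> a0; rewrite (@esum_esum _ _ _ I (fun=> J))// (@esum_esum _ _ _ J (fun=> I))//.
rewrite (reindex_esum (J `*` I) _ (fun z => (z.2, z.1)))//; split => //=.
- by move=> [i j] [].
- by move=> [i1 i2] [j1 j2] /= _ _ [] -> ->.
- by move=> [i1 i2] [Pi1 Qi2] /=; exists (i2, i1).
Qed.

Lemma esum_bij (T T' : choiceType) (e : T -> T') (e' : T' -> T)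
    (a : T' -> \bar R) : cancel e e' -> cancel e' e ->
  \esum_(x in [set: T']) a x = \esum_(x in [set: T]) a (e x).
Proof.
move=> ee' e'e; apply: reindex_esum; split => //.
- by move=> x y _ _; exact: can_inj.
- by move=> y _; exists (e' y).
Qed.

Lemma le_esum_subset (T : choiceType) (I J : set T) (a : T -> \bar R) :
  (forall x, 0 <= a x) -> I `<=` J ->
  \esum_(x in I) a x <= \esum_(x in J) a x.
Proof.
move=> a0 IJ; rewrite esum_mkcond [leRHS]esum_mkcond; apply: le_esum => x _.
case: ifPn => [/set_mem/IJ/mem_set -> //|_]; by case: ifP.
Qed.

Lemma esum_delta (T : choiceType) (t : T) (a : T -> \bar R) :
  (forall x, 0 <= a x) ->
  \esum_(x in [set: T]) ((x == t)%:R%:E * a x) = a t.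
Proof.
move=> a0; rewrite -[RHS](esum_set1 (a0 t)) [RHS]esum_mkcond.
apply: eq_esum => x _.
have [->|xt] := eqVneq x t; first by rewrite mul1e mem_set.
by rewrite mul0e memNset// => /eqP; rewrite (negbTE xt).
Qed.

Lemma esum_fibre (T T' : choiceType) (pi : T -> T') (a : T -> \bar R) :
  (forall x, 0 <= a x) ->
  \esum_(y in [set: T']) \esum_(x in pi @^-1` [set y]) a x =
  \esum_(x in [set: T]) a x.
Proof.
move=> a0; under eq_esum do rewrite esum_mkcond.
rewrite exchange_esum; last by move=> x y; case: ifP.
apply: eq_esum => x _.
rewrite -[RHS](@esum_delta _ (pi x) (fun=> a x))//; apply: eq_esum => y _.
have [->|yx] := eqVneq y (pi x); first by rewrite mem_set// mul1e.
by rewrite memNset ?mul0e// => /= /esym/eqP; rewrite (negbTE yx).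
Qed.

End Sums.

Section Convolution.
Variables (R : realType) (G : groupType).
Local Open Scope ring_scope.
Local Open Scope ereal_scope.
Implicit Types p q r : G -> \bar R.

Definition ge0fun p := forall g, 0 <= p g.
Definition mass p := \esum_(g in [set: G]) p g.
Definition sym_mass p := forall g, p g = p g^-1%g.
Definition delta1 : G -> \bar R := fun g => (g == 1%g)%:R%:E.

Lemma delta1_ge0 : ge0fun delta1.
Proof. by move=> g; rewrite /delta1 lee_fin ler0n. Qed.

Lemma conv_ge0 p q : ge0fun p -> ge0fun q -> ge0fun (convolution p q).
Proof. by move=> p0 q0 g; apply: esum_ge0 => h _; exact: mule_ge0. Qed.

Lemma conv_delta1 q : ge0fun q -> convolution delta1 q = q.
Proof.
move=> q0; apply/funext => g; rewrite /convolution /delta1.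
by rewrite (@esum_delta _ _ 1%g (fun h => q (h^-1 * g)%g))// invg1 mul1g.
Qed.

Lemma esum_translate (h : G) p : \esum_(x in [set: G]) p (h * x)%g = mass p.
Proof.
rewrite [RHS](@esum_bij _ _ _ ( *%g h) ( *%g h^-1)%g)// => x.
  by rewrite mulKg.
by rewrite mulVKg.
Qed.

Lemma esum_inv p : \esum_(x in [set: G]) p x^-1%g = mass p.
Proof. by rewrite [RHS](@esum_bij _ _ _ (fun x : G => x^-1)%g (fun x : G => x^-1)%g)//; exact: invgK. Qed.

Lemma conv_mass p q : ge0fun p -> ge0fun q ->
  mass (convolution p q) = mass p * mass q.
Proof.
move=> p0 q0; rewrite /mass /convolution exchange_esum; last first.
  by move=> x y; exact: mule_ge0.
rewrite -esumZr//; last by exact: esum_ge0.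
by apply: eq_esum => h _; rewrite esumZl// esum_translate.
Qed.

Lemma convA p q r : ge0fun p -> ge0fun q -> ge0fun r ->
  convolution (convolution p q) r = convolution p (convolution q r).
Proof.
move=> p0 q0 r0; apply/funext => g; rewrite /convolution.
transitivity (\esum_(h in [set: G]) \esum_(k in [set: G])
    (p k * q (k^-1 * h)%g * r (h^-1 * g)%g)).
  by apply: eq_esum => h _; rewrite esumZr// => k; rewrite mule_ge0.
rewrite exchange_esum; last by move=> x y; rewrite !mule_ge0.
apply: eq_esum => k _.
rewrite -esumZl//; last by move=> h; rewrite mule_ge0.
rewrite -[LHS](@esum_translate k (fun h => p k * q (k^-1 * h)%g * r (h^-1 * g)%g)).
by apply: eq_esum => h _; rewrite mulKg invgM !mulgA muleA.
Qed.

Lemma le_conv p p' q q' : ge0fun p -> ge0fun q ->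
  (forall g, p g <= p' g) -> (forall g, q g <= q' g) ->
  forall g, convolution p q g <= convolution p' q' g.
Proof. by move=> p0 q0 pp qq g; apply: le_esum => h _; exact: lee_pmul. Qed.

Definition cpow p n := iter n (convolution p) delta1.

Lemma cpow0 p : cpow p 0 = delta1. Proof. by []. Qed.
Lemma cpowS p n : cpow p n.+1 = convolution p (cpow p n). Proof. by []. Qed.

Lemma cpow_ge0 p n : ge0fun p -> ge0fun (cpow p n).
Proof. by move=> p0; elim: n => [|n IH]; [exact: delta1_ge0|exact: conv_ge0]. Qed.

Lemma cpowD p m n : ge0fun p ->
  cpow p (m + n) = convolution (cpow p m) (cpow p n).
Proof.
move=> p0; elim: m => [|m IH]; first by rewrite conv_delta1//; exact: cpow_ge0.
by rewrite addSn !cpowS IH convA//; exact: cpow_ge0.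
Qed.

Lemma cpow1 p : ge0fun p -> cpow p 1 = p.
Proof.
move=> p0; apply/funext => g; rewrite cpowS /convolution cpow0 /delta1.
rewrite -[RHS](@esum_delta _ _ g p)//; apply: eq_esum => h _.
by rewrite muleC mulg_eq1 eqg_inv.
Qed.

Lemma cpowM p m n : ge0fun p -> cpow p (m * n) = cpow (cpow p m) n.
Proof.
move=> p0; elim: n => [|n IH]; first by rewrite muln0.
by rewrite mulnS cpowD// IH.
Qed.

Lemma cpow_mass p n : ge0fun p -> mass (cpow p n) = mass p ^+ n.
Proof.
move=> p0; elim: n => [|n IH].
  rewrite expe0 /mass /= /delta1.
  rewrite -[RHS](@esum_delta _ _ (1%g : G) (fun=> 1))//.
  by apply: eq_esum => x _; rewrite mule1.
by rewrite cpowS conv_mass ?IH// ?expeS//; exact: cpow_ge0.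
Qed.

Lemma le_cpow p q n : ge0fun p -> (forall g, p g <= q g) ->
  forall g, cpow p n g <= cpow q n g.
Proof.
by move=> p0 pq; elim: n => [//|n IH] g; apply: le_conv => //; exact: cpow_ge0.
Qed.

Lemma conv_ge p q x y : ge0fun p -> ge0fun q ->
  p x * q y <= convolution p q (x * y)%g.
Proof.
move=> p0 q0; rewrite -{1}(mulKg x y).
by apply: (@esum_ge1 _ _ _ (fun h => p h * q (h^-1 * (x * y))%g)) => // h;
   rewrite mule_ge0.
Qed.

Lemma cpow_ge p m n x y : ge0fun p ->
  cpow p m x * cpow p n y <= cpow p (m + n) (x * y)%g.
Proof. by move=> p0; rewrite cpowD// conv_ge//; exact: cpow_ge0. Qed.

Lemma conv_inv p q : ge0fun p -> ge0fun q -> sym_mass p -> sym_mass q ->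
  forall g, convolution p q g^-1%g = convolution q p g.
Proof.
move=> p0 q0 ps qs g; rewrite /convolution -[RHS](@esum_translate g (fun h => q h * p (h^-1 * g)%g)).
apply: eq_esum => h _; rewrite muleC; congr (_ * _).
  by rewrite qs invgM !invgK.
by rewrite invgM mulgVK -ps.
Qed.

Lemma sym_cpow p n : ge0fun p -> sym_mass p -> sym_mass (cpow p n).
Proof.
move=> p0 ps; elim: n => [|n IH] g.
  by rewrite cpow0 /delta1 invg_eq1.
rewrite cpowS conv_inv//; last exact: cpow_ge0.
by rewrite -[X in _ = convolution _ X g](cpow1 p0) -cpowD// addn1.
Qed.

(** An even convolution power of a symmetric mass is a correlation, that is an
    inner product of translates: the source of all positivity below. *)
Lemma cpow_double p n g : ge0fun p -> sym_mass p ->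
  cpow p (2 * n) g = \esum_(x in [set: G]) (cpow p n x * cpow p n (g^-1 * x)%g).
Proof.
move=> p0 ps; rewrite mul2n -addnn cpowD//; apply: eq_esum => x _.
by congr (_ * _); rewrite sym_cpow// invgM invgK.
Qed.

Lemma cpow_double1 p n : ge0fun p -> sym_mass p ->
  cpow p (2 * n) 1%g = \esum_(x in [set: G]) (cpow p n x * cpow p n x).
Proof.
by move=> p0 ps; rewrite cpow_double//; apply: eq_esum => x _; rewrite invg1 mul1g.
Qed.

End Convolution.

(** * Spectral radius, quotient maps and mass functions *)

Section Radius.
Variables (R : realType).
Local Open Scope ring_scope.
Local Open Scope ereal_scope.

Lemma powR_inv_le (b r : R) m : (0 <= b)%R -> (0 <= r)%R -> (0 < m)%N ->
  (b `^ m%:R^-1 <= r)%R = (b <= r ^+ m)%R.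
Proof.
move=> b0 r0 m0.
have mN0 : (m%:R != 0 :> R)%R by rewrite pnatr_eq0 -lt0n.
have {2}-> : b = ((b `^ m%:R^-1) ^+ m)%R.
  by rewrite -powR_mulrn ?powR_ge0// -powRrM mulVf// powRr1.
by rewrite ler_pXn2r// nnegrE ?powR_ge0.
Qed.

Variable G : groupType.
Implicit Types p : G -> \bar R.

(** The spectral radius is a supremum and not only an upper limit (see
    [spectral_radiusP]); in this form it can be used without taking roots. *)
Definition is_radius p (r : R) := [/\ (0 <= r)%R,
  (forall n, cpow p (2 * n) 1%g <= (r ^+ (2 * n))%:E) &
  forall r', (0 <= r')%R ->
    (forall n, (0 < n)%N -> cpow p (2 * n) 1%g <= (r' ^+ (2 * n))%:E) ->
    (r <= r')%R].

Lemma cpow_expn p m n : ge0fun p -> cpow p m 1%g ^+ n <= cpow p (m * n) 1%g.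
Proof.
move=> p0; elim: n => [|n IH]; first by rewrite muln0 /= /delta1 eqxx.
have := @cpow_ge _ _ p m (m * n) 1%g 1%g p0.
rewrite expeS mulnS mulg1; apply: le_trans.
by rewrite lee_wpmul2l//; exact: cpow_ge0.
Qed.

Lemma cpow_mass1 p n : ge0fun p -> mass p = 1 -> mass (cpow p n) = 1.
Proof.
by move=> p0 p1; rewrite cpow_mass// p1; elim: n => // n IH; rewrite expeS IH mul1e.
Qed.

Lemma cpow_le1 p n g : ge0fun p -> mass p = 1 -> cpow p n g <= 1.
Proof.
move=> p0 p1; rewrite -(cpow_mass1 n p0 p1).
by apply: esum_ge1 => //; exact: cpow_ge0.
Qed.

Lemma cpow_EFin p n g : ge0fun p -> mass p = 1 ->
  cpow p n g = (fine (cpow p n g))%:E.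
Proof.
move=> p0 p1; rewrite fineK// fin_numElt (lt_le_trans _ (cpow_ge0 n p0 g))//=.
by rewrite (le_lt_trans (cpow_le1 _ _ p0 p1))// ltry.
Qed.

Lemma limn_esup_inf (u : (\bar R)^nat) : limn_esup u = ereal_inf (range (esups u)).
Proof. by rewrite limn_esup_lim; apply: cvg_lim => //; exact: cvg_esups_inf. Qed.

(** Return probabilities are supermultiplicative, so the root at time 2n is
    bounded by the roots at all multiples of n, hence by the upper limit. *)
Lemma spectral_radiusP (mu : set G -> \bar R) :
  let p := fun g => mu [set g] in ge0fun p -> mass p = 1 ->
  exists2 r, spectral_radius mu = r%:E & is_radius p r.
Proof.
move=> p p0 p1.
pose b n := fine (cpow p (2 * n) 1%g).
have bE n : cpow p (2 * n) 1%g = (b n)%:E by exact: cpow_EFin.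
have b0 n : (0 <= b n)%R by rewrite -lee_fin -bE; exact: cpow_ge0.
have b1 n : (b n <= 1)%R by rewrite -lee_fin -bE; exact: cpow_le1.
pose u n := (b n `^ (2 * n)%:R^-1)%R.
have uP n (r : R) : (0 < n)%N -> (0 <= r)%R ->
    (u n <= r)%R = (b n <= r ^+ (2 * n))%R.
  by move=> n0 r0; rewrite powR_inv_le// muln_gt0.
have rhoE : spectral_radius mu = ereal_inf (range (esups (EFin \o u))).
  rewrite /spectral_radius -limn_esup_inf; congr limn_esup; apply/funext => n /=.
  by rewrite -[convolution_power _ _ _]/(cpow p (2 * n) 1%g) bE poweR_EFin.
have lb n : (0 < n)%N -> (u n)%:E <= spectral_radius mu.
  move=> n0; rewrite rhoE; apply: le_ereal_inf_tmp => _ [k _ <-].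
  apply: (@le_trans _ _ (u (n * k.+1)%N)%:E); last first.
    apply: ereal_sup_ubound; exists (n * k.+1)%N => //=.
    by apply: leq_trans (leqnSn k) _; rewrite leq_pmull.
  rewrite lee_fin uP ?powR_ge0//.
  have h : (b n ^+ k.+1 <= b (n * k.+1)%N)%R.
    rewrite -lee_fin -bE mulnA; apply: le_trans (cpow_expn _ _ p0).
    by rewrite bE EFin_expe.
  have u0 : (0 <= u (n * k.+1)%N)%R by exact: powR_ge0.
  have := uP (n * k.+1)%N (u (n * k.+1)%N).
  rewrite lexx muln_gt0 n0 u0 => /(_ isT isT)/esym.
  move=> /(le_trans h); rewrite mulnA exprM ler_pXn2r//= nnegrE//.
  exact: exprn_ge0.
have ub (r : R) : (forall n, (0 < n)%N -> (u n <= r)%R) ->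
    spectral_radius mu <= r%:E.
  move=> ur; rewrite rhoE.
  apply: (@le_trans _ _ (esups (EFin \o u) 1%N)).
    by apply: ereal_inf_lbound; exists 1%N.
  by apply: ge_ereal_sup => _ [n /= n0 <-]; rewrite lee_fin ur.
have ge0 : 0 <= spectral_radius mu.
  by apply: le_trans (lb 1%N isT); rewrite lee_fin powR_ge0.
have le1 : spectral_radius mu <= 1.
  by apply: ub => n n0; rewrite uP// expr1n.
have E : spectral_radius mu = (fine (spectral_radius mu))%:E.
  by rewrite fineK// fin_numElt (lt_le_trans _ ge0)//= (le_lt_trans le1)// ltry.
exists (fine (spectral_radius mu)) => //; split; first exact: fine_ge0.
- case=> [|n]; first by rewrite muln0 expr0 /= /delta1 eqxx.
  by rewrite bE lee_fin -uP ?fine_ge0// -lee_fin -E lb.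
- move=> r r0 h; rewrite -lee_fin -E; apply: ub => n n0.
  by rewrite uP// -lee_fin -bE h.
Qed.

End Radius.

Section Homomorphisms.
Variables (G H : groupType) (f : {multiplicative G -> H}).

Lemma hom1 : f 1 = 1.
Proof. by apply: (mulgI (f 1)); rewrite -gmulfM !mulg1. Qed.

Lemma homV x : f x^-1 = (f x)^-1.
Proof. by apply/divg1_eq; rewrite invgK -gmulfM mulVg hom1. Qed.

End Homomorphisms.

Section Push.
Variables (R : realType).
Local Open Scope ring_scope.
Local Open Scope ereal_scope.

Definition pushmass (G H : groupType) (pi : G -> H) (p : G -> \bar R) : H -> \bar R :=
  fun y => \esum_(x in pi @^-1` [set y]) p x.

Variables (G H : groupType) (pi : {multiplicative G -> H}).
Implicit Types p q : G -> \bar R.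

Lemma push_ge0 p : ge0fun p -> ge0fun (pushmass pi p).
Proof. by move=> p0 y; apply: esum_ge0. Qed.

Lemma push_esum p (k : H -> \bar R) : ge0fun p -> ge0fun k ->
  \esum_(y in [set: H]) (pushmass pi p y * k y) =
  \esum_(x in [set: G]) (p x * k (pi x)).
Proof.
move=> p0 k0; rewrite -(@esum_fibre _ _ _ pi); last first.
  by move=> x; exact: mule_ge0.
apply: eq_esum => y _; rewrite /pushmass -esumZr//.
by apply: eq_esum => x /= ->.
Qed.

Lemma push_mass p : ge0fun p -> mass (pushmass pi p) = mass p.
Proof. by move=> p0; exact: esum_fibre. Qed.

Lemma push_delta1 : pushmass pi (@delta1 R G) = @delta1 R H.
Proof.
apply/funext => y; rewrite /pushmass esum_mkcond.
transitivity (\esum_(x in [set: G]) ((x == 1%g)%:R%:E * (pi x == y)%:R%:E : \bar R)).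
  apply: eq_esum => x _; rewrite /delta1.
  have [pxy|xy] := eqVneq (pi x) y; first by rewrite mule1 mem_set.
  by rewrite mule0 memNset// => /= /eqP; rewrite (negbTE xy).
by rewrite (@esum_delta _ _ 1%g (fun x => (pi x == y)%:R%:E))// hom1 eq_sym.
Qed.

Lemma push_conv p q : ge0fun p -> ge0fun q ->
  pushmass pi (convolution p q) = convolution (pushmass pi p) (pushmass pi q).
Proof.
move=> p0 q0; apply/funext => y.
rewrite /(convolution (pushmass pi p)) push_esum//; last first.
  by move=> z; exact: push_ge0.
transitivity (\esum_(x in [set: G]) (p x * \esum_(z in pi @^-1` [set y]) q (x^-1 * z)%g)).
  rewrite /pushmass /convolution exchange_esum; last by move=> *; exact: mule_ge0.
  by apply: eq_esum => x _; rewrite esumZl.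
apply: eq_esum => x _; congr (_ * _); rewrite /pushmass.
rewrite (@reindex_esum _ _ _ (pi @^-1` [set (pi x)^-1 * y]%g) _ (fun z => x * z)%g).
  by apply: eq_esum => z _; rewrite mulKg.
split.
- by move=> z /=; rewrite gmulfM => ->; rewrite mulVKg.
- by move=> u v _ _; exact: mulgI.
- move=> z /= <-; exists (x^-1 * z)%g; last by rewrite mulVKg.
  by rewrite /= gmulfM homV.
Qed.

Lemma push_cpow p n : ge0fun p -> pushmass pi (cpow p n) = cpow (pushmass pi p) n.
Proof.
move=> p0; elim: n => [|n IH]; first exact: push_delta1.
by rewrite !cpowS push_conv ?IH//; exact: cpow_ge0.
Qed.

Lemma push_sym p : sym_mass p -> sym_mass (pushmass pi p).
Proof.
move=> ps y; rewrite /pushmass (@reindex_esum _ _ _ (pi @^-1` [set y^-1]%g) _ (fun x => x^-1)%g).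
  by apply: eq_esum => x _; rewrite -ps.
split.
- by move=> x /=; rewrite homV => ->; rewrite invgK.
- by move=> u v _ _; exact: invg_inj.
- by move=> x /= <-; exists x^-1%g; rewrite /= ?homV ?invgK.
Qed.

Lemma le_push p x : ge0fun p -> p x <= pushmass pi p (pi x).
Proof. by move=> p0; exact: esum_ge1. Qed.

End Push.

Lemma push_comp (R : realType) (G H K : groupType) (pi : G -> H) (f : H -> K)
  (p : G -> \bar R) : ge0fun p -> pushmass (f \o pi) p = pushmass f (pushmass pi p).
Proof.
move=> p0; apply/funext => z.
rewrite /pushmass (@esum_mkcond _ _ (f @^-1` [set z])).
under [RHS]eq_esum => y _.
  rewrite (_ : (if _ then _ else _) =
    esum (pi @^-1` [set y]) (fun x => if f (pi x) == z then p x else 0%E)).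
    over.
  case: ifPn => [/set_mem/= <-|/negP fy].
    by apply: eq_esum => x /= ->; rewrite eqxx.
  rewrite esum1// => x /= pxy; case: eqP => // fz.
  by case: fy; rewrite inE /= -pxy.
rewrite esum_fibre; last by move=> x; case: ifP.
rewrite esum_mkcond; apply: eq_esum => x _.
by congr (if _ then _ else _); apply/idP/eqP; rewrite inE.
Qed.

Section DiscreteMeasure.
Variables (R : realType) (d : nat) (mu : probability (free_group d) R).
Local Open Scope ring_scope.
Local Open Scope ereal_scope.

Definition pmass (g : free_group d) := mu [set g].

(** The free group is countable: enumerate it by [pickle] and use countable
    additivity. *)
Lemma pmass_esum (A : set (free_group d)) : mu A = \esum_(x in A) pmass x.
Proof.
pose F n : set (free_group d) := A `&` [set x | pickle x = n].
have tF : trivIset setT F.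
  by move=> i j _ _ [x [[_ /= <-] [_ /= <-]]].
have AE : A = \bigcup_n F n.
  by apply/seteqP; split => [x Ax|x [n _ []]//]; exists (pickle x).
rewrite {1}AE measure_bigcup//= nneseries_esum; last by [].
rewrite [RHS](_ : _ = \esum_(x in \bigcup_n F n) pmass x); last by rewrite -AE.
rewrite (_ : [set x | _] = [set: nat]); last first.
  by apply/seteqP; split => x //= _; rewrite in_setT.
rewrite esum_bigcupT//; apply: eq_esum => n _.
have [->|/set0P[x Fx]] := eqVneq (F n) set0.
  by rewrite measure0 esum_set0.
have -> : F n = [set x].
  apply/seteqP; split => [y [Ay yn]|y ->//]; apply: (pcan_inj pickleK).
  by rewrite yn Fx.2.
by rewrite esum_set1.
Qed.

Lemma pmass_ge0 : ge0fun pmass. Proof. by move=> g. Qed.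

Lemma mass_pmass : mass pmass = 1.
Proof. by rewrite /mass -pmass_esum probability_setT. Qed.

Lemma pushforward_pmass (N : normal_subgroup (free_group d))
    (y : quotient_group N) :
  pushforward mu (quotient_map N) [set y] = pushmass (quotient_map N) pmass y.
Proof. by rewrite /pushforward pmass_esum. Qed.

Lemma quotient_radius (N : normal_subgroup (free_group d)) :
  exists2 r, quotient_spectral_radius N mu = r%:E &
    is_radius (pushmass (quotient_map N) pmass) r.
Proof.
have E : (fun y => pushforward mu (quotient_map N) [set y]) =
    pushmass (quotient_map N) pmass.
  by apply/funext => y; rewrite pushforward_pmass.
rewrite /quotient_spectral_radius.
have := @spectral_radiusP R _ (pushforward mu (quotient_map N)).
rewrite /= E; apply.
  exact: push_ge0 pmass_ge0.
by rewrite push_mass ?mass_pmass//; exact: pmass_ge0.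
Qed.

End DiscreteMeasure.

(** * A lower bound for the radius from commuting elements *)

Section Growth.
Variable R : realType.
Local Open Scope ring_scope.

Lemma bernoulli_ineq (t : R) n : 0 <= t -> 1 + n%:R * t <= (1 + t) ^+ n.
Proof.
move=> t0; elim: n => [|n IH]; first by rewrite mul0r addr0 expr0.
rewrite exprS -natr1; have n0 : 0 <= n%:R * t * t by rewrite !mulr_ge0.
have := ler_wpM2l (addr_ge0 ler01 t0) IH; apply: le_trans; nra.
Qed.

(** Induction on the degree: splitting q^j as s^j * s^j with s the square root
    of q, one factor absorbs a power of j by the Bernoulli inequality and the
    other one is still exponential. *)
Lemma exp_beats_poly (q C : R) k : 1 < q ->
  ~ (forall j, q ^+ j <= C * j.+1%:R ^+ k).
Proof.
elim: k q C => [|k IH] q C q1 h.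
  have t0 : 0 < q - 1 by lra.
  have [n hn] : exists n, C / (q - 1) < n%:R.
    exists (Num.bound `|C / (q - 1)|); apply: le_lt_trans (ler_norm _) _.
    exact: archi_boundP.
  have := bernoulli_ineq n (ltW t0); have := h n.
  rewrite expr0 mulr1 [1 + (q - 1)]addrC subrK => h1 h2; move: hn.
  rewrite ltr_pdivrMr// => h3; lra.
pose s := Num.sqrt q.
have s1 : 1 < s by rewrite -(sqrtr1 R) ltr_sqrt; lra.
have sq : q = s * s by rewrite -expr2 sqr_sqrtr; lra.
pose c := Num.min 1 (s - 1).
have c0 : 0 < c by rewrite lt_min; lra.
have cs j : c * j.+1%:R <= s ^+ j.
  have t0 : 0 <= s - 1 by lra.
  have := bernoulli_ineq j t0; rewrite [1 + (s - 1)]addrC subrK; apply: le_trans.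
  rewrite -natr1 mulrDr mulr1 addrC lerD// ?ge_min ?lexx//.
  by rewrite mulrC ler_wpM2l// ge_min lexx orbT.
apply: (IH s (C / c) s1) => j.
have := h j; rewrite sq exprMn => hj.
have sj0 : 0 <= s ^+ j by rewrite exprn_ge0; lra.
have h2 : c * j.+1%:R * s ^+ j <= C * j.+1%:R ^+ k.+1.
  by apply: le_trans hj; rewrite ler_wpM2r.
have j0 : 0 < j.+1%:R :> R by [].
rewrite mulrAC ler_pdivlMr// -(ler_pM2r j0) -[leRHS]mulrA -exprSr.
by apply: le_trans h2; lra.
Qed.

Lemma le_of_poly_growth (x y : R) k : 0 <= y ->
  (forall j, x ^+ (2 * j) <= j.+1%:R ^+ k * y ^+ (2 * j)) -> x <= y.
Proof.
move=> y0 h; rewrite leNgt; apply/negP => yx.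
have [y00|yN0] := eqVneq y 0.
  have := h 1%N; rewrite y00 muln1 expr0n mulr0 => /=.
  by rewrite leNgt exprn_gt0// -y00.
have {}y0 : 0 < y by rewrite lt0r yN0.
have q1 : 1 < (x / y) ^+ 2.
  by rewrite exprn_egt1// ltr_pdivlMr// mul1r.
apply: (@exp_beats_poly ((x / y) ^+ 2) 1 k q1) => j.
rewrite mul1r -exprM expr_div_n ler_pdivrMr ?exprn_gt0//.
Qed.

End Growth.

Section Commuting.
Variable G : groupType.

(** The products of powers of the elements of S, taken in the order of S, with
    exponents at most j.  When the elements of S commute, every product of j of
    them occurs here, and the length of the list is polynomial in j. *)
Fixpoint monomials (S : seq G) j : seq G :=
  if S is s :: S' then
    flatten [seq [seq s ^+ c * x | x <- monomials S' j] | c <- iota 0 j.+1]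
  else [:: 1].

Lemma size_monomials S j : size (monomials S j) = (j.+1 ^ size S)%N.
Proof.
elim: S => [|s S IH] //=.
rewrite -[LHS]/(size (flatten [seq [seq s ^+ c * x | x <- monomials S j] | c <- iota 0 j.+1])).
rewrite size_flatten /shape -map_comp.
rewrite (eq_map (_ : _ =1 fun=> (j.+1 ^ size S)%N)); last first.
  by move=> c /=; rewrite size_map.
by rewrite sumnE big_map big_const_seq count_predT size_iota iter_addn_0 expnSr.
Qed.

Lemma monomialsP s S j g : reflect
  (exists c x, [/\ (c <= j)%N, x \in monomials S j & g = s ^+ c * x])
  (g \in monomials (s :: S) j).
Proof.
apply: (iffP flatten_mapP) => [[c]|[c [x [cj xM ->]]]].
  by rewrite mem_iota /= add0n => cj /mapP[x xM ->]; exists c, x.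
by exists c; [rewrite mem_iota|apply/mapP; exists x].
Qed.

Lemma monomials1 S j : 1 \in monomials S j.
Proof.
elim: S => [|s S IH]; first by rewrite mem_seq1.
by apply/monomialsP; exists 0%N, 1; rewrite expg0 mulg1.
Qed.

Lemma monomials_le S j : {subset monomials S j <= monomials S j.+1}.
Proof.
elim: S => [//|s S IH] g /monomialsP[c [x [cj xM ->]]].
by apply/monomialsP; exists c, x; split => //; [exact: leqW|exact: IH].
Qed.

Lemma monomials_mul S j t x : {in S &, forall s s', commute s s'} ->
  t \in S -> x \in monomials S j -> t * x \in monomials S j.+1.
Proof.
elim: S t x => [//|s S IH] t x comm tS /monomialsP[c [y [cj yM ->]]].
apply/monomialsP; have [ts|tNs] := eqVneq t s.
  exists c.+1, y; split => //; first exact: monomials_le.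
  by rewrite expgS ts mulgA.
have tS' : t \in S by move: tS; rewrite inE (negbTE tNs).
exists c, (t * y); split; first exact: leqW.
  apply: IH => // u v uS vS; apply: comm; rewrite inE ?uS ?vS orbT//.
rewrite !mulgA; congr (_ * y); apply: commuteX.
by apply: comm => //; rewrite mem_head.
Qed.

End Commuting.

Section Lower.
Variable R : realType.
Local Open Scope ring_scope.
Local Open Scope ereal_scope.

Lemma esum_seq (T : choiceType) (X : seq T) (a : T -> \bar R) : uniq X ->
  (forall x, 0 <= a x) -> \esum_(x in [set` X]) a x = \sum_(x <- X) a x.
Proof. move=> uX a0; rewrite fsbig_seq// esum_fset//; exact: finite_seq. Qed.

Lemma esum_supp (T : choiceType) (X : seq T) (a : T -> \bar R) : uniq X ->
  (forall x, 0 <= a x) -> (forall x, x \notin X -> a x = 0) ->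
  \esum_(x in [set: T]) a x = \sum_(x <- X) a x.
Proof.
move=> uX a0 aX; rewrite -esum_seq// [RHS]esum_mkcond; apply: eq_esum => x _.
by case: ifPn => // /negP xX; apply: aX; apply/negP => h; apply: xX; rewrite inE.
Qed.

(** Cauchy-Schwarz against the constant function. *)
Lemma sum_sqr_le (T : Type) (X : seq T) (v : T -> R) :
  ((\sum_(x <- X) v x) ^+ 2 <= (size X)%:R * \sum_(x <- X) v x ^+ 2)%R.
Proof.
elim: X => [|x X IH]; first by rewrite !big_nil expr0n mul0r.
rewrite !big_cons /= -natr1 sqrrD.
set a := (\sum_(_ <- _) v _)%R in IH *; set b := (\sum_(_ <- _) _)%R in IH *.
have H : (v x * a *+ 2 <= (size X)%:R * v x ^+ 2 + b)%R.
  rewrite /a /b; elim: X {IH a b} => [|y X IH] /=.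
    by rewrite !big_nil mulr0 mul0rn mul0r addr0.
  rewrite !big_cons -natr1; have := sqr_ge0 (v x - v y); rewrite sqrrB.
  by move: IH; set a := (\sum_(_ <- _) v _)%R; set b := (\sum_(_ <- _) _)%R; nra.
by rewrite mulrDl !mulrDr !mul1r; lra.
Qed.

Variables (G : groupType) (p : G -> \bar R) (r : R).
Hypotheses (p0 : ge0fun p) (ps : sym_mass p) (p1 : mass p = 1).
Hypothesis pr : is_radius p r.

(** Restrict the m-step mass to S and call sigma its total.  Its j-th power has
    mass sigma^j on at most (j + 1)^|S| points, so the sum of its squares,
    which bounds the return probability at time 2mj from below, is at least
    sigma^(2j) / (j + 1)^|S|.  The polynomial factor disappears in the
    exponential rate. *)
Lemma radius_commuting (S : seq G) m : uniq S ->
  {in S &, forall s s', commute s s'} ->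
  \sum_(s <- S) cpow p m s <= (r ^+ m)%:E.
Proof.
move=> uS comm.
pose w := cpow p m.
have w0 : ge0fun w by exact: cpow_ge0.
pose u g := if g \in S then w g else 0.
have u0 : ge0fun u by move=> g; rewrite /u; case: ifP.
have uw g : u g <= w g by rewrite /u; case: ifP.
have supp j x : x \notin monomials S j -> cpow u j x = 0.
  elim: j x => [|j IH] x xM.
    rewrite cpow0 /delta1; case: eqP => // x1; move: xM.
    by rewrite x1 monomials1.
  rewrite cpowS /convolution esum1// => h _; rewrite /u; case: ifPn => hS.
    rewrite IH ?mule0//; apply: contra xM => hM.
    by rewrite -(mulVKg h x) monomials_mul.
  by rewrite mul0e.
have cE j x : cpow u j x = (fine (cpow u j x))%:E.
  rewrite fineK// fin_numElt (lt_le_trans _ (cpow_ge0 j u0 x))//=.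
  have := le_cpow j u0 uw x; rewrite -cpowM// => /le_lt_trans; apply.
  by rewrite (le_lt_trans (cpow_le1 _ _ p0 p1))// ltry.
have wE x : w x = (fine (w x))%:E by exact: cpow_EFin.
pose sigma : R := (\sum_(s <- S) fine (w s))%R.
have sE : \sum_(s <- S) cpow p m s = sigma%:E.
  by rewrite /sigma -sumEFin; apply: eq_bigr => s _; rewrite -wE.
have mu_ : mass u = sigma%:E.
  rewrite -sE /mass (esum_supp uS)//; last by move=> x; rewrite /u => /negbTE->.
  by apply: eq_big_seq => s sS; rewrite /u sS.
rewrite sE lee_fin; have [r0 rub _] := pr.
apply: (@le_of_poly_growth _ _ _ (size S)); first by rewrite exprn_ge0.
move=> j; rewrite -natrX -size_monomials.
pose X := undup (monomials S j).
have XE : (sigma ^+ j = \sum_(x <- X) fine (cpow u j x))%R.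
  apply: EFin_inj; rewrite -sumEFin EFin_expe -mu_ -cpow_mass//.
  rewrite /mass (@esum_supp _ X) ?undup_uniq//.
  - by apply: eq_bigr => x _; rewrite -cE.
  - by move=> x; exact: cpow_ge0.
  - by move=> x; rewrite mem_undup => /supp.
rewrite mulnC exprM XE; apply: le_trans (sum_sqr_le _ _) _.
apply: ler_pM => //; first by apply: sumr_ge0 => x _; exact: sqr_ge0.
  by rewrite ler_nat size_undup.
rewrite -exprM mulnA mulnC -lee_fin.
apply: le_trans (rub (m * j)%N).
rewrite cpow_double1// -sumEFin.
apply: (@le_trans _ _ (\esum_(x in [set` X]) (cpow p (m * j) x * cpow p (m * j) x))).
  rewrite esum_seq ?undup_uniq//; last first.
    by move=> x; rewrite mule_ge0//; exact: cpow_ge0.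
  apply: lee_sum => x _; rewrite expr2 EFinM -cE; apply: lee_pmul.
  - exact: cpow_ge0.
  - exact: cpow_ge0.
  - by rewrite cpowM//; exact: le_cpow.
  - by rewrite cpowM//; exact: le_cpow.
by apply: le_esum_subset => // x; rewrite mule_ge0//; exact: cpow_ge0.
Qed.

End Lower.

(** * Paradoxical decompositions and almost invariant functions *)

Section RealSums.
Variables (R : realType) (T : choiceType).
Local Open Scope ring_scope.
Implicit Types (f g : T -> R) (a b : R).

(** Carrying the real value of a convergent sum along makes the estimates below
    linear arithmetic over the reals. *)
Definition has_sum f a :=
  (forall x, 0 <= f x) /\ \esum_(x in [set: T]) (f x)%:E = a%:E.

Lemma has_sumD f g a b : has_sum f a -> has_sum g b ->
  has_sum (fun x => f x + g x) (a + b).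
Proof.
move=> [f0 fa] [g0 gb]; split; first by move=> x; rewrite addr_ge0.
rewrite EFinD -fa -gb -esumD// => x _; rewrite lee_fin//.
Qed.

Lemma has_sumZ c f a : 0 <= c -> has_sum f a -> has_sum (fun x => c * f x) (c * a).
Proof.
move=> c0 [f0 fa]; split; first by move=> x; rewrite mulr_ge0.
by rewrite EFinM -fa -esumZl// => x; rewrite lee_fin.
Qed.

Lemma has_sum_le f g a b : has_sum f a -> has_sum g b ->
  (forall x, f x <= g x) -> a <= b.
Proof.
move=> [f0 fa] [g0 gb] fg; rewrite -lee_fin -fa -gb.
by apply: le_esum => x _; rewrite lee_fin.
Qed.

Lemma has_sum_ge0 f a : has_sum f a -> 0 <= a.
Proof.
by move=> [f0 fa]; rewrite -lee_fin -fa; apply: esum_ge0 => x _; rewrite lee_fin.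
Qed.

Lemma has_sum_dom f g b : has_sum g b -> (forall x, 0 <= f x <= g x) ->
  exists a, has_sum f a.
Proof.
move=> [g0 gb] fg; exists (fine (\esum_(x in [set: T]) (f x)%:E)).
split; first by move=> x; case/andP: (fg x).
rewrite fineK// ge0_fin_numE; last first.
  by apply: esum_ge0 => x _; rewrite lee_fin; case/andP: (fg x).
apply: (@le_lt_trans _ _ b%:E); last exact: ltry.
by rewrite -gb; apply: le_esum => x _; rewrite lee_fin; case/andP: (fg x).
Qed.

End RealSums.

Lemma has_sum_translate (R : realType) (G : groupType) (h : G) (f : G -> R) a :
  has_sum f a -> has_sum (fun x => f (h * x)) a.
Proof.
move=> [f0 fa]; split=> [x//|].
by rewrite (esum_translate h (fun x => (f x)%:E)).
Qed.

Section Paradoxical.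
Variables (R : realType) (G : groupType).
Local Open Scope ring_scope.

(** If f were almost invariant under a and b, the mass m of f^2 on E would be at
    least A/2, because E and its a-preimage cover G, and at most A/3, because
    E and two b-preimages are disjoint.  Quantitatively, u^2 is at most
    (5/4) v^2 + 5 (v - u)^2, and 5/4 is close enough to 1 for the
    contradiction between 1/2 and 1/3 to survive. *)
Lemma paradoxical_gap (E : pred G) (a b : G) (f : G -> R) A Da Db :
  (forall x, E x || E (a * x)%g) ->
  (forall x, E x -> ~~ E (b * x)%g && ~~ E (b * (b * x))%g) ->
  has_sum (fun x => f x ^+ 2) A ->
  has_sum (fun x => (f (a * x)%g - f x) ^+ 2) Da ->
  has_sum (fun x => (f (b * x)%g - f x) ^+ 2) Db ->
  A <= 300%:R * (Da + Db).
Proof.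
move=> Ea Eb hA hDa hDb.
pose e x : R := (E x)%:R.
have e01 x : 0 <= e x <= 1 by rewrite /e; case: (E x); rewrite ?lexx ler01.
have dom (k : G) : exists m, has_sum (fun x => e (k * x)%g * f x ^+ 2) m.
  apply: has_sum_dom hA _ => x; have /andP[e0 e1] := e01 (k * x)%g.
  by have := sqr_ge0 (f x); nra.
have [m hm] := dom 1%g; have [ma hma] := dom a.
have [mb hmb] := dom b; have [mbb hmbb] := dom (b * b)%g.
have sq u v : u ^+ 2 <= (5%:R / 4%:R) * v ^+ 2 + 5%:R * (v - u) ^+ 2 :> R.
  by have := sqr_ge0 (5%:R * v - 4%:R * u); lra.
(* E and its preimage under a cover G. *)
have i1 : A <= m + ma.
  apply: has_sum_le hA (has_sumD hm hma) _ => x; rewrite mul1g /e.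
  by have := Ea x; have := sqr_ge0 (f x); case: (E x); case: (E _) => //=; nra.
have i2 : ma <= (5%:R / 4%:R) * m + 5%:R * Da.
  apply: has_sum_le hma (has_sumD (has_sumZ _ (has_sum_translate a hm)) (has_sumZ _ hDa)) _ => // x.
  have /andP[e0 e1] := e01 (a * x)%g; rewrite mul1g.
  have := sq (f x) (f (a * x)%g); have := sqr_ge0 (f (a * x)%g - f x).
  by rewrite /e; case: (E _) => /=; nra.
have i3 : m <= (5%:R / 4%:R) * mb + 5%:R * Db.
  apply: has_sum_le (has_sum_translate b hm) (has_sumD (has_sumZ _ hmb) (has_sumZ _ hDb)) _ => // x.
  rewrite mul1g.
  have := sq (f (b * x)%g) (f x); have := sqr_ge0 (f (b * x)%g - f x).
  by rewrite /e; case: (E _) => /=; nra.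
have i4 : m <= (5%:R / 4%:R) * mbb + 5%:R * (2%:R * Db + 2%:R * Db).
  apply: has_sum_le (has_sum_translate (b * b)%g hm) (has_sumD (has_sumZ _ hmbb)
    (has_sumZ _ (has_sumD (has_sumZ _ (has_sum_translate b hDb)) (has_sumZ _ hDb)))) _ => // x.
  rewrite mul1g -mulgA.
  have := sq (f (b * (b * x))%g) (f x).
  have := sqr_ge0 (f (b * (b * x))%g - 2%:R * f (b * x)%g + f x).
  have := sqr_ge0 (f (b * (b * x))%g - f (b * x)%g).
  have := sqr_ge0 (f (b * x)%g - f x).
  by rewrite /e; case: (E _) => /=; nra.
(* E and its preimages under b and b^2 are pairwise disjoint. *)
have i5 : m + (mb + mbb) <= A.
  apply: has_sum_le (has_sumD hm (has_sumD hmb hmbb)) hA _ => x.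
  rewrite mul1g -mulgA /e; have := sqr_ge0 (f x).
  have := Eb x; have := Eb (b * x)%g.
  by case: (E x); case: (E (b * x)%g); case: (E (b * (b * x))%g) => //=;
    rewrite ?andbF => // h1 h2; try (by have := h1 isT); try (by have := h2 isT); lra.
have := has_sum_ge0 hDa; have := has_sum_ge0 hDb.
lra.
Qed.

End Paradoxical.

(** * Return probabilities and superharmonic functions *)

Section Green.
Variables (R : realType) (G : groupType) (p : G -> \bar R).
Local Open Scope ring_scope.
Local Open Scope ereal_scope.
Hypotheses (p0 : ge0fun p) (ps : sym_mass p) (p1 : mass p = 1).

(** Cauchy-Schwarz: an inner product of two translates of f is at most the
    square norm of f. *)
Lemma cpow_even_le n g : cpow p (2 * n) g <= cpow p (2 * n) 1%g.
Proof.
have E k x : cpow p k x = (fine (cpow p k x))%:E by exact: cpow_EFin.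
suff : cpow p (2 * n) g + cpow p (2 * n) g <=
       cpow p (2 * n) 1%g + cpow p (2 * n) 1%g.
  by rewrite (E _ g) (E _ 1%g) -!EFinD !lee_fin; lra.
have c0 := @cpow_ge0 _ _ p n p0.
have m0 (u v : G) : 0 <= cpow p n u * cpow p n v by rewrite mule_ge0.
have T := @esum_translate _ _ g^-1%g (fun x => cpow p n x * cpow p n x).
rewrite [in leLHS]cpow_double// [X in _ <= _ + X]cpow_double1//.
rewrite -[X in _ <= _ + X]T cpow_double1//.
rewrite -!esumD//; apply: le_esum => x _.
rewrite (E _ x) (E _ (g^-1 * x)%g) -!EFinM -!EFinD lee_fin.
set u := fine _; set v := fine _.
by have := sqr_ge0 (u - v)%R; rewrite sqrrB; lra.
Qed.

Variable r : R.
Hypothesis pr : is_radius p r.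

Lemma radius_gt0 : (0 < r)%R.
Proof.
have [r0 rub _] := pr.
have [r00|] := eqVneq r 0%R; last by rewrite lt0r r0 andbT.
have [x px] : exists x, 0 < p x.
  apply: contrapT => /forallNP h.
  have : mass p = 0.
    apply: esum1 => x _; apply/eqP; rewrite eq_le p0 andbT.
    by rewrite leNgt; apply/negP; exact: h.
  by rewrite p1 => /eqP; rewrite onee_eq0.
have := rub 1%N; rewrite r00 expr0n /= => h.
have := @cpow_ge _ _ p 1 1 x x^-1%g p0.
rewrite mulgV cpow1// -ps => /le_trans/(_ h).
by rewrite leNgt mule_gt0.
Qed.

(** At odd times the value is an average of values at the preceding even time;
    the factor 1 + r^-1 pays for the missing step. *)
Lemma cpow_le_radius n g : cpow p n g <= ((1 + r^-1) * r ^+ n)%:E.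
Proof.
have r0 := radius_gt0; have [_ rub _] := pr.
have even m x : cpow p (2 * m) x <= (r ^+ (2 * m))%:E.
  exact: le_trans (cpow_even_le _ _) (rub m).
have := odd_double_half n; rewrite -mul2n; case: (odd n) => /= <-.
  rewrite add1n cpowS; apply: (@le_trans _ _ (r ^+ (2 * n./2))%:E); last first.
    rewrite lee_fin mulrDl mul1r exprS mulKf ?gt_eqF// lerDr mulr_ge0//.
      exact: ltW.
    by rewrite exprn_ge0// ltW.
  apply: (@le_trans _ _ (\esum_(h in [set: G]) (p h * (r ^+ (2 * n./2))%:E))).
    by apply: le_esum => h _; rewrite lee_wpmul2l.
  rewrite esumZr//; last by rewrite lee_fin exprn_ge0// ltW.
  by rewrite -/(mass p) p1 mul1e.
rewrite add0n; apply: le_trans (even _ _) _.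
rewrite lee_fin mulrDl mul1r lerDl mulr_ge0// ?invr_ge0 ?exprn_ge0//; exact: ltW.
Qed.

Lemma esum_geometric (q : R) : (0 <= q)%R -> (q < 1)%R ->
  \esum_(n in [set: nat]) (q ^+ n)%:E <= ((1 - q)^-1)%:E.
Proof.
move=> q0 q1; have q10 : (0 < 1 - q)%R by lra.
have s0 n : 0 <= (q ^+ n)%:E by rewrite lee_fin exprn_ge0.
rewrite -nneseries_esumT//; apply: lime_le.
  by apply: is_cvg_nneseries => n _ _; exact: s0.
apply: nearW => n; rewrite sumEFin lee_fin -[leRHS]mul1r ler_pdivlMr//.
suff -> : ((\sum_(0 <= i < n) q ^+ i) * (1 - q) = 1 - q ^+ n)%R.
  by rewrite gerBl exprn_ge0.
elim: n => [|n IH]; first by rewrite big_nil mul0r expr0 subrr.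
by rewrite big_nat_recr//= mulrDl IH exprS; ring.
Qed.

Hypothesis ndeg : forall g, exists n, 0 < cpow p n g.

(** The Green function: the sum over n of lam^-n times the n-step mass.  It
    converges because lam exceeds the radius, is positive because every
    element is reached, and a step of the walk shifts the sum by one. *)
Lemma exists_superharmonic (lam : R) : (r < lam)%R ->
  exists h : G -> R, (forall g, (0 < h g)%R) /\
    forall k g, convolution (cpow p k) (EFin \o h) g <= (lam ^+ k * h g)%:E.
Proof.
move=> rlam; have r0 := radius_gt0; have l0 : (0 < lam)%R by lra.
pose H g := \esum_(n in [set: nat]) ((lam ^- n)%:E * cpow p n g).
have li0 n : 0 <= (lam ^- n)%:E.
  by rewrite lee_fin invr_ge0 exprn_ge0// ltW.
have t0 n g : 0 <= (lam ^- n)%:E * cpow p n g.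
  by rewrite mule_ge0//; exact: cpow_ge0.
have H0 : ge0fun H by move=> g; apply: esum_ge0 => n _.
have Hfin g : H g < +oo.
  apply: (@le_lt_trans _ _ ((1 + r^-1)%:E * ((1 - r / lam)^-1)%:E)); last first.
    by rewrite -EFinM ltry.
  have c0 : 0 <= (1 + r^-1)%:E by rewrite lee_fin addr_ge0// invr_ge0 ltW.
  have q0 : (0 <= r / lam)%R by rewrite divr_ge0// ltW.
  apply: (@le_trans _ _ (\esum_(n in [set: nat]) ((1 + r^-1)%:E * ((r / lam) ^+ n)%:E))).
    apply: le_esum => n _.
    apply: le_trans (lee_wpmul2l (li0 n) (cpow_le_radius n g)) _.
    by rewrite -!EFinM lee_fin expr_div_n mulrC -!mulrA lexx.
  rewrite esumZl//; last by move=> n; rewrite lee_fin exprn_ge0.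
  by rewrite lee_wpmul2l// esum_geometric// ltr_pdivrMr// mul1r.
have HE g : H g = (fine (H g))%:E by rewrite fineK// ge0_fin_numE.
have Hpos g : 0 < H g.
  have [n png] := ndeg g.
  apply: (@lt_le_trans _ _ ((lam ^- n)%:E * cpow p n g)).
    by rewrite mule_gt0// lte_fin invr_gt0 exprn_gt0.
  by apply: (@esum_ge1 _ _ _ (fun n => (lam ^- n)%:E * cpow p n g)).
exists (fine \o H); split=> [g|]; first by rewrite -lte_fin /= -HE.
have -> : EFin \o (fine \o H) = H by apply/funext => g /=; rewrite -HE.
have step g : convolution p H g <= lam%:E * H g.
  rewrite /convolution /H -esumZl//; last exact: ltW.
  under eq_esum => h _ do rewrite -esumZl//.
  rewrite exchange_esum; last by move=> x n; rewrite mule_ge0.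
  apply: (@le_trans _ _ (\esum_(n in [set: nat]) (lam%:E * ((lam ^- n.+1)%:E * cpow p n.+1 g)))).
    apply: le_esum => n _.
    rewrite muleA -EFinM exprS invfM mulrA mulfV ?gt_eqF// mul1r cpowS /convolution.
    rewrite -esumZl//; last by move=> x; rewrite mule_ge0//; exact: cpow_ge0.
    by apply: le_esum => x _; rewrite muleCA.
  rewrite -(@esum_image _ _ _ [set: nat] S (fun n => lam%:E * ((lam ^- n)%:E * cpow p n g))); last first.
    by move=> x y _ _ [].
  by apply: le_esum_subset => // n; rewrite mule_ge0// lee_fin ltW.
elim=> [|k IH] g.
  by rewrite cpow0 conv_delta1// expr0 mul1r -HE.
rewrite -addn1 cpowD// cpow1// convA//; last exact: cpow_ge0.
apply: (@le_trans _ _ (convolution (cpow p k) (fun g => lam%:E * H g) g)).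
  by apply: le_conv => //; [exact: cpow_ge0|exact: conv_ge0].
rewrite /convolution; under eq_esum => x _ do rewrite muleCA.
rewrite esumZl ?lee_fin ?(ltW l0)//; last by move=> x; rewrite mule_ge0//; exact: cpow_ge0.
rewrite addn1 exprS -mulrA EFinM; apply: lee_wpmul2l (IH g).
by rewrite lee_fin ltW.
Qed.

End Green.

(** * Strict decrease of the radius under a nonamenable kernel *)

Section Schur.
Variables (R : realType) (G : groupType).
Local Open Scope ring_scope.
Local Open Scope ereal_scope.

(** The pointwise bound is AM-GM with the weights H(gx) / H(x) and their
    inverses; after summation against a symmetric w both halves of the
    right-hand side agree, by the change of variables (g, x) to (g^-1, gx).
    D records what the pointwise bound leaves unused. *)
Lemma schur_test (w : G -> \bar R) (H f : G -> R) (D : G -> G -> R) (L : R) :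
  ge0fun w -> sym_mass w -> (0 <= L)%R -> (forall x, (0 < H x)%R) ->
  (forall x, \esum_(g in [set: G]) (w g * (H (g * x)%g)%:E) <= (L * H x)%:E) ->
  (forall g x, (f x * f (g * x)%g + f x * f (g * x)%g + D g x <=
    f x ^+ 2 * (H (g * x)%g / H x) + f (g * x)%g ^+ 2 * (H x / H (g * x)%g))%R) ->
  \esum_(g in [set: G]) \esum_(x in [set: G])
    (w g * (f x * f (g * x)%g + f x * f (g * x)%g + D g x)%:E) <=
  (L + L)%:E * \esum_(x in [set: G]) (f x ^+ 2)%:E.
Proof.
move=> w0 ws L0 H0 wH key.
pose T g x := (f x ^+ 2 * (H (g * x)%g / H x))%R.
have T0 g x : 0 <= (T g x)%:E.
  by rewrite lee_fin mulr_ge0 ?sqr_ge0// divr_ge0// ltW.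
have wT0 g x : 0 <= w g * (T g x)%:E by rewrite mule_ge0.
pose S := \esum_(g in [set: G]) \esum_(x in [set: G]) (w g * (T g x)%:E).
have S_le : S <= L%:E * \esum_(x in [set: G]) (f x ^+ 2)%:E.
  rewrite /S exchange_esum// -esumZl ?lee_fin//; last first.
    by move=> x; rewrite lee_fin sqr_ge0.
  apply: le_esum => x _.
  rewrite (_ : esum _ _ = (f x ^+ 2 / H x)%:E *
      \esum_(g in [set: G]) (w g * (H (g * x)%g)%:E)); last first.
    rewrite -esumZl ?lee_fin ?divr_ge0 ?sqr_ge0 ?(ltW (H0 x))//; last first.
      by move=> g; rewrite mule_ge0// lee_fin ltW.
    apply: eq_esum => g _; rewrite muleCA -EFinM; congr (_ * _%:E).
    by rewrite /T mulrCA mulrC -!mulrA [(_^-1 * _)%R]mulrC.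
  apply: le_trans (lee_wpmul2l _ (wH x)) _.
    by rewrite lee_fin divr_ge0 ?sqr_ge0// ltW.
  rewrite -!EFinM lee_fin.
  rewrite (_ : (_ / _ * _)%R = (L * f x ^+ 2)%R)//.
  by have := H0 x => /lt0r_neq0 Hx; field.
have S_sym : S = \esum_(g in [set: G]) \esum_(x in [set: G])
    (w g * (f (g * x)%g ^+ 2 * (H x / H (g * x)%g))%:E).
  rewrite /S -[LHS](esum_inv (fun g => \esum_(x in [set: G]) (w g * (T g x)%:E))).
  apply: eq_esum => g _.
  rewrite -[LHS](esum_translate g (fun x => w g^-1%g * (T g^-1%g x)%:E)).
  by apply: eq_esum => x _; rewrite -ws /T mulKg.
apply: (@le_trans _ _ (S + S)); last first.
  rewrite EFinD ge0_muleDl ?lee_fin//; exact: leeD.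
rewrite {2}S_sym -esumD; last 2 first.
- by move=> g _; apply: esum_ge0.
- move=> g _; apply: esum_ge0 => x _.
  by rewrite mule_ge0// lee_fin mulr_ge0 ?sqr_ge0// divr_ge0// ltW.
apply: le_esum => g _; rewrite -esumD; last 2 first.
- by move=> x _.
- move=> x _.
  by rewrite mule_ge0// lee_fin mulr_ge0 ?sqr_ge0// divr_ge0// ltW.
apply: le_esum => x _.
rewrite -ge0_muleDr//; last first.
  by rewrite lee_fin mulr_ge0 ?sqr_ge0// divr_ge0// ltW.
by rewrite lee_wpmul2l// -EFinD lee_fin; exact: key.
Qed.

End Schur.

Section Strict.
Variables (R : realType) (G K : groupType) (pi : {multiplicative G -> K}).
Variable p : G -> \bar R.
Local Open Scope ring_scope.
Local Open Scope ereal_scope.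
Hypotheses (p0 : ge0fun p) (ps : sym_mass p) (p1 : mass p = 1).
Hypothesis ndeg : forall y, exists n, 0 < cpow (pushmass pi p) n y.
Variables (r : R) (E : pred G) (a b : G) (k : nat).
Hypothesis pr : is_radius (pushmass pi p) r.
Hypotheses (ka : pi a = 1%g) (kb : pi b = 1%g).
Hypotheses (wa : 0 < cpow p (2 * k) a) (wb : 0 < cpow p (2 * k) b).
Hypothesis Ea : forall x, E x || E (a * x)%g.
Hypothesis Eb : forall x, E x -> ~~ E (b * x)%g && ~~ E (b * (b * x))%g.

Let w := cpow p (2 * k).
Let kappa := Num.min (fine (w a)) (fine (w b)).

Let w0 : ge0fun w. Proof. exact: cpow_ge0. Qed.
Let wE g : w g = (fine (w g))%:E. Proof. exact: cpow_EFin. Qed.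

Lemma kappa_gt0 : (0 < kappa)%R.
Proof. by rewrite lt_min -!lte_fin -!wE wa. Qed.

(** The Schur test for f = the n-step mass, whose square norm is the return
    probability at time 2n.  The superharmonic weight comes from K, so it is
    invariant under a and b in the kernel of pi, where AM-GM loses exactly the
    squared difference of f; [paradoxical_gap] bounds that loss below.  The
    test bounds twice the return probability and is used once for a and once
    for b, so the constant 1200 is 4 times the constant of the gap. *)
Lemma return_decay_lam lam n : (r < lam)%R ->
  cpow p (2 * k + 2 * n) 1%g <=
  (lam ^+ (2 * k) - kappa / 1200%:R)%:E * cpow p (2 * n) 1%g.
Proof.
move=> rlam.
have q0 : ge0fun (pushmass pi p) by exact: push_ge0.
have q1 : mass (pushmass pi p) = 1 by rewrite push_mass.
have r0 := radius_gt0 q0 (push_sym pi ps) q1 pr.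
have [h [h0 hsup]] := exists_superharmonic q0 (push_sym pi ps) q1 pr ndeg rlam.
pose f x := fine (cpow p n x).
have fE x : cpow p n x = (f x)%:E by exact: cpow_EFin.
pose D g x := (if pi g == 1%g then (f (g * x)%g - f x) ^+ 2 else 0)%R.
have D0 g x : (0 <= D g x)%R by rewrite /D; case: ifP => // _; exact: sqr_ge0.
have f0 x : (0 <= f x)%R by rewrite -lee_fin -fE cpow_ge0.
pose L := (lam ^+ (2 * k))%R.
have L0 : (0 <= L)%R by rewrite exprn_ge0//; lra.
set A := fine (cpow p (2 * n) 1%g).
have AE : cpow p (2 * n) 1%g = A%:E by exact: cpow_EFin.
have sumA : has_sum (fun x => f x ^+ 2)%R A.
  split=> [x|]; first exact: sqr_ge0.
  rewrite -AE cpow_double1//; apply: eq_esum => x _.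
  by rewrite fE -EFinM -expr2.
have DDsum g : exists s, has_sum (fun x => (f (g * x)%g - f x) ^+ 2)%R s.
  apply: has_sum_dom (has_sumD (has_sum_translate g sumA) sumA) _ => x.
  rewrite sqr_ge0 /=; have := f0 x; have := f0 (g * x)%g; nra.
have [Da hDa] := DDsum a; have [Db hDb] := DDsum b.
have gap := paradoxical_gap Ea Eb sumA hDa hDb.
have schur := @schur_test R G w (h \o pi) f D L w0 (sym_cpow _ p0 ps) L0
  (fun x => h0 (pi x)).
have {schur} := schur _ _; rewrite sumA.2 => schur.
have wsum : \esum_(g in [set: G]) \esum_(x in [set: G])
    (w g * (f x * f (g * x)%g + f x * f (g * x)%g + D g x)%:E) <= ((L + L) * A)%:E.
  rewrite EFinM; apply: schur => [x|g x].
    apply: le_trans (hsup (2 * k)%N (pi x)) => /=.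
    rewrite -push_cpow// /convolution push_esum//.
    - rewrite -[leRHS]esum_inv; apply: le_esum => g _.
      by rewrite -(sym_cpow _ p0 ps) -homV invgK -gmulfM.
    - by move=> y; rewrite lee_fin ltW.
  have [hx hgx] := (h0 (pi x), h0 (pi (g * x)%g)).
  rewrite /D /=; case: ifPn => [/eqP g1|_].
    rewrite gmulfM g1 mul1g divff ?lt0r_neq0// !mulr1; nra.
  set u := f x; set v := f (g * x)%g; set c := h _; set e := h _.
  have -> : (u ^+ 2 * (c / e) + v ^+ 2 * (e / c) =
     u * v + u * v + 0 + (u * c - v * e) ^+ 2 / (e * c))%R.
    by field; rewrite !lt0r_neq0.
  by rewrite lerDl divr_ge0 ?sqr_ge0// mulr_ge0// ltW.
set B := fine (cpow p (2 * k + 2 * n) 1%g).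
have BE : cpow p (2 * k + 2 * n) 1%g = B%:E by exact: cpow_EFin.
have sumB : \esum_(g in [set: G]) \esum_(x in [set: G]) (w g * (f x * f (g * x)%g)%:E) = B%:E.
  rewrite -BE cpowD//; apply: eq_esum => g _.
  rewrite mulg1 (@cpow_double _ _ p n)// -esumZl//; last first.
    by move=> x; rewrite mule_ge0//; exact: cpow_ge0.
  by apply: eq_esum => x _; rewrite invgK !fE -EFinM.
have fin_le c Dc : pi c = 1%g -> has_sum (fun x => (f (c * x)%g - f x) ^+ 2)%R Dc ->
    (B + B + fine (w c) * Dc <= (L + L) * A)%R.
  move=> c1 hc; rewrite -lee_fin; apply: le_trans wsum.
  rewrite !EFinD -!sumB -esumD; last 2 first.
  - by move=> g _; apply: esum_ge0 => x _; rewrite mule_ge0// lee_fin mulr_ge0.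
  - by move=> g _; apply: esum_ge0 => x _; rewrite mule_ge0// lee_fin mulr_ge0.
  have wD0 g : 0 <= \esum_(x in [set: G]) (w g * (D g x)%:E).
    by apply: esum_ge0 => x _; rewrite mule_ge0// lee_fin.
  apply: (@le_trans _ _ (\esum_(g in [set: G])
    ((\esum_(x in [set: G]) (w g * (f x * f (g * x)%g)%:E) +
      \esum_(x in [set: G]) (w g * (f x * f (g * x)%g)%:E)) +
      \esum_(x in [set: G]) (w g * (D g x)%:E)))).
    rewrite [leRHS]esumD//; last first.
      move=> g _; apply: adde_ge0; apply: esum_ge0 => x _;
      by rewrite mule_ge0// lee_fin mulr_ge0.
    apply: leeD => //.
    apply: (@le_trans _ _ (\esum_(x in [set: G]) (w c * (D c x)%:E))); last first.
      by apply: (@esum_ge1 _ _ _ (fun g => \esum_(x in [set: G]) (w g * (D g x)%:E))).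
    rewrite esumZl//; last by move=> x; rewrite lee_fin.
    rewrite EFinM -wE (_ : \esum_(x in _) _ = Dc%:E)// -hc.2.
    by apply: eq_esum => x _; rewrite /D c1 eqxx.
  apply: le_esum => g _.
  rewrite -!esumD; try by move=> x _; rewrite ?adde_ge0 ?mule_ge0// lee_fin ?mulr_ge0.
  apply: le_esum => x _.
  by rewrite EFinD EFinD !ge0_muleDr ?adde_ge0 ?lee_fin ?mulr_ge0.
have ia := fin_le a Da ka hDa; have ib := fin_le b Db kb hDb.
rewrite BE AE -EFinM lee_fin -/L.
have k0 := kappa_gt0.
have ka' : (kappa <= fine (w a))%R by rewrite ge_min lexx.
have kb' : (kappa <= fine (w b))%R by rewrite ge_min lexx orbT.
have Da0 := has_sum_ge0 hDa; have Db0 := has_sum_ge0 hDb.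
have ja : (kappa * Da <= fine (w a) * Da)%R by rewrite ler_wpM2r.
have jb : (kappa * Db <= fine (w b) * Db)%R by rewrite ler_wpM2r.
have jA : (kappa * A <= kappa * (300%:R * (Da + Db)))%R by rewrite ler_pM2l.
lra.
Qed.

Lemma powR_invK (x : R) m : (0 <= x)%R -> (0 < m)%N ->
  ((x `^ m%:R^-1) ^+ m = x)%R.
Proof.
move=> x0 m0; rewrite -powR_mulrn ?powR_ge0// -powRrM mulVf ?powRr1//.
by rewrite pnatr_eq0 -lt0n.
Qed.

Hypothesis k_gt0 : (0 < k)%N.

(** The loss does not depend on lam, so lam may be taken so close to r that
    half of the loss remains; iterating the decay gives a geometric bound at
    the multiples of 2k, and supermultiplicativity extends it to all even
    times. *)
Lemma radius_strict (s : R) : is_radius p s -> (s < r)%R.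
Proof.
move=> [s0 _ smin]; have [r0 _ _] := pr; have kap := kappa_gt0.
have k2 : (0 < 2 * k)%N by rewrite muln_gt0.
(* The root of x is used as lam: its power exceeds that of r by half the loss. *)
pose x := (r ^+ (2 * k) + kappa / 2400%:R)%R.
have rk0 : (0 <= r ^+ (2 * k))%R by rewrite exprn_ge0.
have rlam : (r < x `^ (2 * k)%:R^-1)%R.
  rewrite -(@ltr_pXn2r _ (2 * k))// ?nnegrE ?powR_ge0//.
  by rewrite powR_invK// /x; lra.
pose th := (r ^+ (2 * k) - kappa / 2400%:R)%R.
have decay n : cpow p (2 * k + 2 * n) 1%g <= th%:E * cpow p (2 * n) 1%g.
  have := return_decay_lam n rlam; rewrite powR_invK//; last by rewrite /x; lra.
  by rewrite (_ : x - _ = th)%R// /x /th; lra.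
have th0 : (0 <= th)%R.
  have := decay 0%N; rewrite muln0 addn0 cpow0 /delta1 eqxx mule1 => h.
  by rewrite -lee_fin; apply: le_trans h; exact: cpow_ge0.
have pow n : cpow p (2 * k * n) 1%g <= (th ^+ n)%:E.
  elim: n => [|n IH]; first by rewrite muln0 cpow0 /delta1 eqxx.
  rewrite mulnS -mulnA; apply: le_trans (decay (k * n)%N) _.
  by rewrite exprS EFinM lee_wpmul2l ?lee_fin// mulnA.
pose t := (th `^ (2 * k)%:R^-1)%R.
have t0 : (0 <= t)%R by exact: powR_ge0.
apply: (@le_lt_trans _ _ t); last first.
  rewrite -(@ltr_pXn2r _ (2 * k))// ?nnegrE// powR_invK// /th.
  lra.
apply: smin => // n _.
have c0 := @cpow_ge0 _ _ p (2 * n) p0 1%g.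
have cE := cpow_EFin (2 * n) 1%g p0 p1.
have := cpow_expn (2 * n) k p0.
rewrite mulnAC => /le_trans/(_ (pow n)); rewrite cE -EFin_expe !lee_fin => h.
rewrite -(@ler_pXn2r _ k)// ?nnegrE ?exprn_ge0//; last first.
  by rewrite -lee_fin -cE.
by rewrite -exprM mulnAC exprM powR_invK.
Qed.

End Strict.

(** * Words and heights in the free group *)

Section Words.
Variable d : nat.
Implicit Types (a : letter d) (w : seq (letter d)) (u v x : free_group d).

Definition gen a : free_group d := @FreeGroup d [:: a] isT.

Definition elt w : free_group d := foldr (fun a x => gen a * x) 1 w.

Lemma word_mul_gen a x : word (gen a * x) = push a x.
Proof. by []. Qed.

Lemma word_elt w : word (elt w) = foldr (@push d) [::] w.
Proof. by elim: w => //= a w ->. Qed.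

Lemma word_elt_reduced w : reduced w -> word (elt w) = w.
Proof. by move=> rw; rewrite word_elt foldr_push1. Qed.

Lemma eltK x : elt x = x.
Proof. by apply: val_inj; rewrite /= word_elt_reduced ?reduced_word. Qed.

Lemma elt_cat w1 w2 : elt (w1 ++ w2) = elt w1 * elt w2.
Proof. by elim: w1 => [|a w1 IH] /=; rewrite ?mul1g// IH mulgA. Qed.

Lemma elt1 a : elt [:: a] = gen a. Proof. by rewrite /= mulg1. Qed.

Lemma elt_rcons w a : elt (rcons w a) = elt w * gen a.
Proof. by rewrite -cats1 elt_cat elt1. Qed.

Lemma genV a : gen (letter_inv a) = (gen a)^-1.
Proof. exact: val_inj. Qed.

Lemma letter_inv_neq a : letter_inv a != a.
Proof. by apply/eqP => /(congr1 snd) /=; case: a.2. Qed.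

Lemma reduced_catl w1 w2 : reduced (w1 ++ w2) -> reduced w1.
Proof. by rewrite /reduced; case: w1 => //= a w1; rewrite cat_path => /andP[]. Qed.

Lemma reduced_catr w1 w2 : reduced (w1 ++ w2) -> reduced w2.
Proof.
rewrite /reduced; elim: w1 => //= a w1 IH /path_sorted; exact: IH.
Qed.

Lemma reduced_rcons w c a : reduced (rcons w c) -> c != letter_inv a ->
  reduced (rcons (rcons w c) a).
Proof.
move=> r ca; have ac : a != letter_inv c.
  by apply: contraNneq ca => ->; rewrite letter_invK.
move: r; rewrite /reduced; case: w => [|b w] /=; first by rewrite ac.
by rewrite !rcons_path last_rcons => ->.
Qed.

Lemma elt_neq1 w : reduced w -> w != [::] -> elt w <> 1.
Proof.
by move=> rw /eqP wN0 e; apply: wN0; rewrite -(word_elt_reduced rw) e.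
Qed.

Definition sgn_letter a : int := if a.2 then (- 1)%R else 1%R.
(** The total exponent sum, a homomorphism to the integers that moves by one
    along each edge of the Cayley graph. *)
Definition height w : int := (\sum_(a <- w) sgn_letter a)%R.

Lemma height_nil : height [::] = 0%R.
Proof. exact: big_nil. Qed.

Lemma height_cons a w : height (a :: w) = (sgn_letter a + height w)%R.
Proof. exact: big_cons. Qed.

Lemma height_push a w : height (push a w) = (sgn_letter a + height w)%R.
Proof.
case: w => [|b w] /=; first by rewrite height_cons.
case: eqP => [->|_]; last by rewrite height_cons.
by rewrite height_cons /sgn_letter /=; case: a.2 => /=; lia.
Qed.

Lemma height_foldr w1 w2 : height (foldr (@push d) w2 w1) = (height w1 + height w2)%R.
Proof.
elim: w1 => [|a w1 IH] /=; first by rewrite height_nil add0r.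
by rewrite height_push IH height_cons addrA.
Qed.

Lemma heightM u v : height (u * v) = (height u + height v)%R.
Proof. exact: height_foldr. Qed.

Lemma height1 : height (1 : free_group d) = 0%R.
Proof. exact: big_nil. Qed.

Lemma heightV u : height u^-1 = (- height u)%R.
Proof. by have := heightM u^-1 u; rewrite mulVg height1; lia. Qed.

Lemma height_elt w : height (elt w) = height w.
Proof.
elim: w => [|a w IH]; first by [].
by rewrite heightM IH height_cons /= height_cons height_nil addr0.
Qed.

Lemma height_bound w : (- (size w)%:Z <= height w <= (size w)%:Z)%R.
Proof.
elim: w => [|a w IH]; first by rewrite height_nil.
by rewrite height_cons /= /sgn_letter; case: a.2; lia.
Qed.

(** Take a letter a whose index is not that of the first letter of u: then a u
    starts with a, while u a starts with the first letter of u, even when its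
    last letter cancels. *)
Lemma center_trivial (hd : (2 <= d)%N) u : u <> 1 -> exists a, gen a * u <> u * gen a.
Proof.
move=> u1; have [b [w uE]] : exists b w, word u = b :: w.
  case E : (word u) => [|b w]; last by exists b, w.
  by case: u1; apply: val_inj.
have [j jb] : exists j : 'I_d, j != b.1.
  pose i0 : 'I_d := Ordinal (ltnW hd); pose i1 : 'I_d := Ordinal hd.
  by have [<-|] := eqVneq i0 b.1; [exists i1|exists i0].
pose a : letter d := (j, false); exists a => e.
have ru := reduced_word u.
have left : word (gen a * u) = a :: word u.
  rewrite word_mul_gen uE /=; case: eqP => // ba; move: jb.
  by rewrite ba eqxx.
have : head a (word (u * gen a)) = b.
  have [v [c uE2]] : exists (v : seq (letter d)) c, word u = rcons v c.
    by rewrite uE lastI; exists (belast b w), (last b w).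
  have [ca|ca] := eqVneq c (letter_inv a).
    have -> : u * gen a = elt v.
      rewrite -[u in LHS]eltK uE2 elt_rcons ca genV mulgVK//.
    rewrite word_elt_reduced; last by apply: (@reduced_catl _ [:: c]); rewrite cats1 -uE2.
    move: uE uE2; case: (v) => [|b' v'] -> /=.
      by move=> [bc _]; move: jb; rewrite bc ca eqxx.
    by case.
  have -> : u * gen a = elt (rcons u a) by rewrite elt_rcons eltK.
  rewrite word_elt_reduced ?uE//.
  by rewrite -uE uE2; apply: reduced_rcons ca; rewrite -uE2.
rewrite -e left /= => ab; move: jb; by rewrite -ab eqxx.
Qed.

End Words.

(** * Labelled paths and the intermediate normal subgroup *)

Section Cocycle.
Variables (d : nat) (P : normal_subgroup (free_group d)) (Q : groupType).
Variable lab : free_group d -> letter d -> Q.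
Hypothesis lab_inv : forall x a, lab (x * gen a) (letter_inv a) = (lab x a)^-1.
Hypothesis labP : forall p x a, nsubgroup P p -> lab (p * x) a = lab x a.
Implicit Types (u v x : free_group d) (w : seq (letter d)).

(** The product of the labels along the path that reads w from the vertex x.
    Vertices of the Cayley graph of F / P are represented by elements of F,
    with labels that are constant on cosets. *)
Fixpoint coc x w : Q :=
  if w is a :: w' then lab x a * coc (x * gen a) w' else 1.

Lemma coc_push x a w : coc x (push a w) = lab x a * coc (x * gen a) w.
Proof.
case: w => [//|b w] /=; case: eqP => [->|//] /=.
by rewrite lab_inv mulVKg genV mulgK.
Qed.

Lemma coc_foldr x w1 w2 :
  coc x (foldr (@push d) w2 w1) = coc x w1 * coc (x * elt w1) w2.
Proof.
elim: w1 x => [|a w1 IH] x /=; first by rewrite mul1g mulg1.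
by rewrite coc_push IH !mulgA.
Qed.

Lemma cocM x u v : coc x (u * v) = coc x u * coc (x * u) v.
Proof. by rewrite [LHS]coc_foldr eltK. Qed.

Lemma coc1 x : coc x (1 : free_group d) = 1. Proof. by []. Qed.

Lemma coc_shift p x w : nsubgroup P p -> coc (p * x) w = coc x w.
Proof.
by move=> Pp; elim: w x => //= a w IH x; rewrite labP// -mulgA IH.
Qed.

Lemma coc_shiftr p x w : nsubgroup P p -> coc (x * p) w = coc x w.
Proof.
move=> Pp; have -> : x * p = (p ^ x^-1) * x by rewrite /conjg invgK mulgA mulgVK.
exact/coc_shift/nsubgroupJ.
Qed.

Lemma coc_VM x u v : nsubgroup P u ->
  coc x (u^-1 * v) = (coc x u)^-1 * coc x v.
Proof.
move=> Pu; have Pu' := nsubgroupV Pu.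
have := cocM x u (u^-1 * v); rewrite mulVKg coc_shiftr// => ->.
by rewrite mulKg.
Qed.

(** Used with the trivial submonoid and with double centralizers. *)
Lemma coc_in (D : Q -> Prop) x w : D 1 -> (forall y z, D y -> D z -> D (y * z)) ->
  (forall w1 a w2, w = w1 ++ a :: w2 -> D (lab (x * elt w1) a)) -> D (coc x w).
Proof.
move=> D1 DM; elim: w x => //= a w IH x h; apply: (DM).
  by have := h [::] a w erefl; rewrite /= mulg1.
by apply: IH => w1 b w2 E; have := h (a :: w1) b w2; rewrite /= E mulgA; exact.
Qed.

(** The kernel of the action of F on the product of F / P and Q that multiplies
    the second coordinate by the label of the path. *)
Definition cocycle_kernel : set (free_group d) :=
  [set m | nsubgroup P m /\ forall x, coc x m = 1].

Definition cocycle_kernel_normal : normal_subgroup (free_group d).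
Proof.
apply: (@NormalSubgroup _ cocycle_kernel).
- by split; [exact: nsubgroup1|].
- move=> u v [Pu cu] [Pv cv]; split; first exact: nsubgroupM.
  by move=> x; rewrite cocM cu cv mulg1.
- move=> u [Pu cu]; split; first exact: nsubgroupV.
  by move=> x; rewrite -[u^-1]mulg1 coc_VM// cu coc1 mulg1 invg1.
- move=> u y [Pu cu]; split; first exact: nsubgroupJ.
  move=> x; rewrite /conjg cocM cocM cu mul1g coc_shiftr// -cocM mulVg.
  exact: coc1.
Defined.

Lemma kernel_commute u v : nsubgroup P u -> nsubgroup P v ->
  (forall x, commute (coc x u) (coc x v)) ->
  commute (quotient_map cocycle_kernel_normal u) (quotient_map cocycle_kernel_normal v).
Proof.
move=> Pu Pv uv; rewrite /commute -!gmulfM; apply/quotient_mapP.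
have Puv : nsubgroup P (u * v) by exact: nsubgroupM.
split.
  by apply: nsubgroupM; [exact: nsubgroupV|exact: nsubgroupM].
move=> x; rewrite coc_VM// !cocM !coc_shiftr// (uv x).
by rewrite mulVg.
Qed.

(** The label of a path from the identity depends only on its end point in the
    quotient by the kernel, so it is a function on that quotient. *)
Lemma coc_quotient u :
  coc 1 (repr (quotient_map cocycle_kernel_normal u)) = coc 1 u.
Proof.
have [_ cm] := repr_quotient_map cocycle_kernel_normal u.
have := cocM 1 u (u^-1 * repr (quotient_map cocycle_kernel_normal u)).
by rewrite mulVKg cm mulg1.
Qed.

End Cocycle.

Section DoubleCentralizer.
Variable Q : groupType.

(** The double centralizer of b: a commutative subgroup that contains b, which
    stands in for the cyclic group generated by b and needs no exponents. *)
Definition dcent (b q : Q) := forall z, commute z b -> commute z q.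

Lemma dcent1 b : dcent b 1. Proof. by move=> z _; exact: commute1. Qed.
Lemma dcent_self b : dcent b b. Proof. by []. Qed.
Lemma dcentM b y z : dcent b y -> dcent b z -> dcent b (y * z).
Proof. by move=> hy hz t tb; apply: commuteM; [exact: hy|exact: hz]. Qed.
Lemma dcentV b y : dcent b y -> dcent b y^-1.
Proof. by move=> hy t tb; apply: commuteV; exact: hy. Qed.
Lemma dcent_commute b y z : dcent b y -> dcent b z -> commute y z.
Proof.
move=> hy hz; apply: hz; apply/commute_sym; apply: hy.
exact: commute_refl.
Qed.

End DoubleCentralizer.

Section TwoEdges.
Variables (d : nat) (P : normal_subgroup (free_group d)) (Q : groupType).
Variables (b1 b2 : Q) (l : letter d) (h : free_group d).
Local Open Scope ring_scope.
Hypothesis P_height : forall x, nsubgroup P x -> height x = 0.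
Implicit Types (u v x : free_group d) (w : seq (letter d)).

(** The oriented edge that leaves the vertex y along the letter l. *)
Definition at_edge (y x : free_group d) a := (a == l) && `[< nsubgroup P (y^-1 * x)%g >].

(** Crossing the marked edge at 1 gives b1, the one at h gives b2; the inverse
    letters are the reversed edges and give the inverse labels. *)
Definition edge_lab x a : Q :=
  if at_edge 1%g x a then b1
  else if at_edge 1%g (x * gen a)%g (letter_inv a) then b1^-1%g
  else if at_edge h x a then b2
  else if at_edge h (x * gen a)%g (letter_inv a) then b2^-1%g
  else 1%g.

Lemma edge_lab_inv x a : edge_lab (x * gen a)%g (letter_inv a) = ((edge_lab x a)^-1)%g.
Proof.
rewrite /edge_lab genV mulgK letter_invK.
have excl y x1 x2 : at_edge y x1 a -> at_edge y x2 (letter_inv a) = false.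
  by rewrite /at_edge => /andP[/eqP -> _]; rewrite (negbTE (letter_inv_neq l)).
case E1 : (at_edge 1%g x a); first by rewrite (excl _ _ _ E1).
case: ifP => _; first by rewrite invgK.
case E2 : (at_edge h x a); first by rewrite (excl _ _ _ E2).
by case: ifP => _; rewrite ?invgK ?invg1.
Qed.

Lemma at_edge_shift p y x a : nsubgroup P p -> at_edge y (p * x)%g a = at_edge y x a.
Proof.
move=> Pp; rewrite /at_edge; congr (_ && _); apply: asbool_equiv_eq.
have Pq : nsubgroup P (p ^ y)%g by exact: nsubgroupJ.
have E : (y^-1 * (p * x) = (p ^ y) * (y^-1 * x))%g by rewrite /conjg !mulgA mulgK.
split=> [|Px]; last by rewrite E; exact: nsubgroupM.
by rewrite E => /(nsubgroupM (nsubgroupV Pq)); rewrite mulKg.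
Qed.

Lemma edge_labP p x a : nsubgroup P p -> edge_lab (p * x)%g a = edge_lab x a.
Proof. by move=> Pp; rewrite /edge_lab -!mulgA !(at_edge_shift _ _ _ Pp). Qed.

Lemma at_edge_height y x a : at_edge y x a -> height x = height y.
Proof.
by move=> /andP[_ /asboolP/P_height]; rewrite heightM heightV; lia.
Qed.

Local Notation coc := (coc edge_lab).

Lemma height_split x w w1 a w2 : w = w1 ++ a :: w2 ->
  (height x - (size w)%:Z <= height (x * elt w1)%g <= height x + (size w)%:Z) /\
  (height x - (size w)%:Z <= height (x * elt w1 * gen a)%g <= height x + (size w)%:Z).
Proof.
move=> ->; rewrite -mulgA -elt_rcons !heightM !height_elt size_cat /=.
by have := height_bound w1; have := height_bound (rcons w1 a); rewrite size_rcons; lia.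
Qed.

(** Elements of P have height 0, so the height of a vertex is well defined and
    a short path that starts at a height far from 0 cannot reach the edge
    labelled b1. *)
Lemma coc_far1 x w : (size w)%:Z < height x \/ height x < - (size w)%:Z ->
  dcent b2 (coc x w).
Proof.
move=> far; apply: coc_in; [exact: dcent1|exact: dcentM|] => w1 a w2 E.
have [hx hxa] := height_split x E.
have n0 y c : at_edge 1%g y c -> height y = 0 by move/at_edge_height; rewrite height1.
rewrite /edge_lab; case: ifP => [/n0 H|_]; first by lia.
case: ifP => [/n0 H|_]; first by lia.
case: ifP => _; first exact: dcent_self.
by case: ifP => _; [exact/dcentV/dcent_self|exact: dcent1].
Qed.

Lemma coc_far2 x w :
  height h + (size w)%:Z < height x \/ height x < height h - (size w)%:Z ->
  dcent b1 (coc x w).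
Proof.
move=> far; apply: coc_in; [exact: dcent1|exact: dcentM|] => w1 a w2 E.
have [hx hxa] := height_split x E.
rewrite /edge_lab; case: ifP => [_|_]; first exact: dcent_self.
case: ifP => _; first exact/dcentV/dcent_self.
case: ifP => [/at_edge_height H|_]; first by lia.
by case: ifP => [/at_edge_height H|_]; [lia|exact: dcent1].
Qed.

(** No starting point is within n of both heights 0 and height h, so paths of
    length at most n from x all miss the same one of the two edges. *)
Lemma coc_commute u v n : (size u <= n)%N -> (size v <= n)%N ->
  (2 * n)%:Z < height h -> forall x, commute (coc x u) (coc x v).
Proof.
move=> un vn hn x.
have [hx|hx] := leP (height x) n%:Z.
  by apply: (@dcent_commute _ b1); apply: coc_far2; lia.
by apply: (@dcent_commute _ b2); apply: coc_far1; lia.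
Qed.

Lemma coc_avoid x w : l \notin w -> letter_inv l \notin w -> coc x w = 1%g.
Proof.
move=> lw lVw; apply: (@coc_in _ _ _ (fun q => q = 1%g)) => //.
  by move=> y z -> ->; rewrite mulg1.
move=> w1 a w2 E; have aw : a \in w by rewrite E mem_cat mem_head orbT.
have al : (a == l) = false by apply: contraNF lw => /eqP <-.
have aVl : (letter_inv a == l) = false.
  by apply: contraNF lVw => /eqP <-; rewrite letter_invK.
by rewrite /edge_lab /at_edge al aVl.
Qed.

End TwoEdges.

(** * Short loops and ping-pong *)

Section ShortestLoop.
Variables (d : nat) (P : normal_subgroup (free_group d)) (Q : groupType).
Variables (b1 b2 : Q) (l : letter d) (h p : free_group d) (w : seq (letter d)).
Local Open Scope ring_scope.
Hypothesis P_height : forall x, nsubgroup P x -> height x = 0.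
Hypotheses (pE : word p = l :: w) (Pp : nsubgroup P p).
Hypothesis p_min : forall x, nsubgroup P x -> x <> 1%g -> (size p <= size x)%N.

Local Notation coc := (coc (edge_lab P b1 b2 l h)).

Lemma short_notin w1 : reduced w1 -> w1 != [::] -> (size w1 < size p)%N ->
  ~ nsubgroup P (elt w1).
Proof.
move=> rw wN0 sw Pw; have := p_min Pw (elt_neq1 rw wN0).
by rewrite word_elt_reduced// leqNgt sw.
Qed.

(** A proper prefix of a shortest loop is not a loop, since it would be a
    shorter one.  The loop cannot come back through its first edge at the
    very end either: it would be l u l^-1, and u would be a shorter loop. *)
Lemma shortest_simple w1 a w2 : w = w1 ++ a :: w2 ->
  ~ nsubgroup P (elt (l :: w1)) /\
  (a = letter_inv l -> ~ nsubgroup P (elt (l :: w1) * gen a)%g).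
Proof.
move=> wE; have rp := reduced_word p; have sp : size p = (size w1 + size w2).+2.
  by rewrite pE wE /= size_cat /= addnS.
have pE1 : word p = (l :: w1) ++ a :: w2 by rewrite pE wE.
have pE2 : word p = (l :: rcons w1 a) ++ w2 by rewrite cat_cons cat_rcons pE wE.
split.
  apply: short_notin => //; last by rewrite sp /= -addSn -addSn leq_addr.
  by apply: (@reduced_catl _ _ (a :: w2)); rewrite -pE1.
move=> aE Pa; have [w20|w2N0] := eqVneq w2 [::]; last first.
  apply: (@short_notin (l :: rcons w1 a)) => //.
  - by apply: (@reduced_catl _ _ w2); rewrite -pE2.
  - rewrite sp /= size_rcons !ltnS -addn1 leq_add2l.
    by case: (w2) w2N0.
  - by rewrite -rcons_cons elt_rcons.
have {}pE1 : word p = l :: rcons w1 (letter_inv l) by rewrite pE1 w20 cats1 aE.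
have Pw1 : nsubgroup P (elt w1).
  have := nsubgroupJ (gen l) Pp; rewrite -[p]eltK pE1 -rcons_cons elt_rcons genV /=.
  by rewrite /conjg mulgVK mulKg.
apply: short_notin Pw1.
- apply: (@reduced_catl _ w1 [:: letter_inv l]); rewrite cats1.
  by apply: (@reduced_catr _ [:: l]); rewrite cat1s -pE1.
- apply/eqP => w10; move: rp; rewrite pE1 w10 /reduced /=.
  by rewrite eqxx.
- by rewrite sp; lia.
Qed.

(** After its first edge, the loop crosses neither marked edge: not the one at
    its own base point by [shortest_simple], and not the other one, which is
    higher or lower than the loop reaches. *)
Lemma coc_tail y : y = 1%g \/ y = h -> (size p)%:Z < height h -> coc (y * gen l)%g w = 1%g.
Proof.
move=> yE hh; apply: (@coc_in _ _ _ (fun q => q = 1%g)) => //.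
  by move=> u v -> ->; rewrite mulg1.
move=> w1 a w2 wE; have [n1 n2] := shortest_simple wE.
have := height_bound (l :: w1); have := height_bound (l :: rcons w1 a).
have szp : size p = (size w1 + size w2).+2 by rewrite pE wE /= size_cat /= addnS.
rewrite /= size_rcons => hb1 hb2.
have -> : (y * gen l * elt w1 = y * elt (l :: w1))%g by rewrite -mulgA.
have E1 : height (y * elt (l :: w1))%g = height y + height (l :: w1).
  by rewrite heightM height_elt.
have E2 : height (y * elt (l :: w1) * gen a)%g = height y + height (l :: rcons w1 a).
  by rewrite -mulgA -elt_rcons heightM height_elt.
have no z : z = 1%g \/ z = h ->
    at_edge P l z (y * elt (l :: w1))%g a = false /\
    at_edge P l z (y * elt (l :: w1) * gen a)%g (letter_inv a) = false.
  move=> zE; split; apply/negP => H.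
  - have := at_edge_height P_height H; rewrite E1 => hz.
    have yz : y = z.
      move: yE zE hz => [->|->] [->|->] //; rewrite height1 => hz; exfalso; lia.
    by case/andP: H => _ /asboolP; rewrite yz mulKg.
  - have := at_edge_height P_height H; rewrite E2 => hz.
    have yz : y = z.
      move: yE zE hz => [->|->] [->|->] //; rewrite height1 => hz; exfalso; lia.
    case/andP: H => /eqP al /asboolP; rewrite yz -mulgA mulKg; apply: n2.
    by rewrite -al letter_invK.
have [e1 e2] := no 1%g (or_introl erefl); have [e3 e4] := no h (or_intror erefl).
by rewrite /edge_lab e1 e2 e3 e4.
Qed.

Lemma coc_base1 : (size p)%:Z < height h -> coc 1%g p = b1.
Proof.
move=> hh; rewrite pE /= coc_tail ?mulg1//; last by left.
rewrite /edge_lab /at_edge eqxx invg1 mulg1 /= asboolT//.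
exact: nsubgroup1.
Qed.

Lemma coc_base2 : (size p)%:Z < height h -> coc h p = b2.
Proof.
move=> hh; rewrite pE /= coc_tail ?mulg1//; last by right.
have hN : at_edge P l 1%g h l = false.
  by apply/negP => /(at_edge_height P_height); rewrite height1; lia.
rewrite /edge_lab hN /at_edge (negbTE (letter_inv_neq l)) /=.
rewrite eqxx mulVg asboolT//; exact: nsubgroup1.
Qed.

End ShortestLoop.

Section PingPong.
Variables (d : nat) (i j : 'I_d).
Hypothesis ij : i != j.
Implicit Types q : free_group d.

Definition starts q := if word q is a :: _ then a.1 == i else false.

(** Together with [starts_iter] this is the ping-pong for the set of words
    whose first letter has index i: the square of x_i, which pushes every word
    outside the set into it, and the powers of x_j, which push the set off
    itself. *)
Lemma starts_sqr q : starts q || starts (gen (i, false) * gen (i, false) * q).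
Proof.
rewrite -mulgA /starts !word_mul_gen; case: (word q) => [|a w] /=.
  by rewrite /letter_inv /= ?xpair_eqE ?andbF /= ?eqxx.
have [//|ai] := eqVneq a.1 i.
have aN b : (a == (i, b)) = false by apply: contraNF ai => /eqP ->.
by rewrite /push /letter_inv /= aN /= xpair_eqE andbF eqxx.
Qed.

Lemma starts_other n q : starts q ->
  word (iter n.+1 ( *%g (gen (j, false))) q) = nseq n.+1 (j, false) ++ word q.
Proof.
move=> sq; elim: n => [|n IH].
  rewrite /=; move: sq; rewrite /starts; case: (word q) => //= a w /eqP ai.
  case: eqP => // aj; move: ij; rewrite -ai aj /=.
  by rewrite eqxx.
rewrite iterS word_mul_gen IH /=.
by rewrite /letter_inv /= xpair_eqE andbF.
Qed.

Lemma starts_iter n q : starts q -> ~~ starts (iter n.+1 ( *%g (gen (j, false))) q).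
Proof. by move=> sq; rewrite /starts starts_other//= eq_sym. Qed.

End PingPong.

Section Construction.
Variables (d : nat) (hd : (2 <= d)%N) (P : normal_subgroup (free_group d)).
Local Open Scope ring_scope.
Hypothesis P_height : forall x, nsubgroup P x -> height x = 0.
Hypothesis P_neq1 : exists2 x, nsubgroup P x & x <> 1%g.

Lemma shortest_exists : exists p, [/\ nsubgroup P p, p <> 1%g &
  forall x, nsubgroup P x -> x <> 1%g -> (size p <= size x)%N].
Proof.
pose pr n := `[< exists x, [/\ nsubgroup P x, x <> 1%g & size x = n] >].
have ex : exists n, pr n.
  by case: P_neq1 => x Px x1; exists (size x); apply/asboolP; exists x.
case: (ex_minnP ex) => n /asboolP[p [Pp p1 sp]] nmin; exists p; split => // x Px x1.
by rewrite sp; apply: nmin; apply/asboolP; exists x.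
Qed.

(** The squares of a and b occur because an element of the support of an odd
    convolution power need not lie in the support of an even one, while its
    square does. *)
Lemma exists_intermediate (S : seq (free_group d)) :
  (forall s, s \in S -> nsubgroup P s) ->
  exists M : normal_subgroup (free_group d),
    [/\ nsubgroup M `<=` nsubgroup P,
        {in S &, forall s t, commute (quotient_map M s) (quotient_map M t)} &
        exists (a b : free_group d) (E : pred (quotient_group M)),
          [/\ nsubgroup P a, nsubgroup P b,
              forall x, E x || E (quotient_map M (a * a)%g * x)%g &
              forall x, E x -> ~~ E (quotient_map M (b * b)%g * x)%g &&
                ~~ E (quotient_map M (b * b)%g * (quotient_map M (b * b)%g * x))%g]].
Proof.
move=> SP; have [p [Pp p1 pmin]] := shortest_exists.
have [l [w pE]] : exists l w, word p = l :: w.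
  by case E : (word p) => [|l w]; [case: p1; apply: val_inj|exists l, w].
have [j jl] : exists j : 'I_d, l.1 != j.
  pose i0 : 'I_d := Ordinal (ltnW hd); pose i1 : 'I_d := Ordinal hd.
  by have [->|] := eqVneq l.1 i0; [exists i1|exists i0].
pose n := (size p + \max_(s <- S) size (word s))%N.
have Sn s : s \in S -> (size s <= n)%N.
  by move=> sS; rewrite /n (big_rem s)//= maxnC; apply: leq_trans (leq_maxr _ _) (leq_addl _ _).
(* h is a power of a letter whose index is not that of l, so that the path from
   1 to h crosses no marked edge; n bounds the length of the loop p and of the words of S. *)
pose hw := nseq (2 * n).+1 ((j, false) : letter d).
have hwr : reduced hw.
  rewrite /hw /reduced /=; elim: (2 * n)%N => //= k ->.
  by rewrite /letter_inv /= xpair_eqE andbF.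
have [h hdef] : exists h, h = elt hw by exists (elt hw).
have hE : word h = hw by rewrite hdef word_elt_reduced.
have hh : height h = (2 * n).+1%:Z.
  rewrite hdef height_elt /hw; elim: (_.+1) => [|k IH] /=; first by rewrite height_nil.
  by rewrite height_cons IH /sgn_letter /=; lia.
have nl c : (j, c) != l by apply: contraNneq jl => <-.
pose b1 := gen (l.1, false); pose b2 := gen (j, false).
pose lab := edge_lab P b1 b2 l h.
have lab_inv := edge_lab_inv P b1 b2 l h : forall x a, lab (x * gen a)%g (letter_inv a) = (lab x a)^-1%g.
have labP := @edge_labP d P _ b1 b2 l h : forall p x a, nsubgroup P p -> lab (p * x)%g a = lab x a.
pose M := cocycle_kernel_normal lab_inv labP.
have ph : (size p)%:Z < height h by rewrite hh /n; lia.
have c1p : coc lab 1%g p = b1 by exact: (coc_base1 b1 b2 P_height pE Pp pmin ph).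
have chp : coc lab h p = b2 by exact: (coc_base2 b1 b2 P_height pE Pp pmin ph).
have c1h : coc lab 1%g h = 1%g.
  rewrite hE; apply: coc_avoid; rewrite mem_nseq /=.
    by rewrite eq_sym.
  rewrite -(inj_eq (can_inj (@letter_invK d))) letter_invK eq_sym.
  exact: (nl true).
pose t := (p ^ h^-1)%g.
have Pt : nsubgroup P t by exact: nsubgroupJ.
have tE : (t * h = h * p)%g by rewrite /t /conjg invgK mulgA mulgVK.
have c1t : coc lab 1%g t = b2.
  have cth : coc lab t h = 1%g.
    by have := coc_shift labP 1%g h Pt; rewrite mulg1 c1h.
  have := cocM lab_inv 1%g t h; rewrite tE (cocM lab_inv) !mul1g c1h mul1g chp.
  by rewrite cth mulg1 => <-.
have q1 u x : nsubgroup P u -> coc lab 1%g (u * x)%g = (coc lab 1%g u * coc lab 1%g x)%g.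
  move=> Pu; rewrite (cocM lab_inv) mul1g; congr (_ * _)%g.
  by have := coc_shift labP 1%g x Pu; rewrite mulg1.
exists M; split.
- by move=> x [].
- move=> s s' sS sS'; apply: kernel_commute; [exact: SP|exact: SP|].
  apply: (@coc_commute d P _ b1 b2 l h P_height s s' n (Sn _ sS) (Sn _ sS')).
  by rewrite hh; lia.
pose E (x : quotient_group M) := starts l.1 (coc lab 1%g (repr x)).
have EM u : E (quotient_map M u) = starts l.1 (coc lab 1%g u).
  by rewrite /E coc_quotient.
exists p, t, E; split => // [x|x].
  rewrite -[x]quotient_mapK -gmulfM !EM q1//; last exact: nsubgroupM.
  by rewrite (q1 p)// c1p; exact: starts_sqr.
rewrite -[x]quotient_mapK -!gmulfM !EM => sx.
have Ptt : nsubgroup P (t * t)%g by exact: nsubgroupM.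
rewrite !(q1 (t * t)%g)// (q1 t)// c1t -!mulgA.
by rewrite (starts_iter jl 1 sx) (starts_iter jl 3 sx).
Qed.

End Construction.

(** * Assembling the intermediate quotient *)

Section Positivity.
Variables (R : realType) (G : groupType) (p : G -> \bar R).
Local Open Scope ring_scope.
Local Open Scope ereal_scope.
Hypotheses (p0 : ge0fun p) (ps : sym_mass p) (p1 : mass p = 1).

Lemma cpow_return_gt0 l : 0 < cpow p (2 * l) 1%g.
Proof.
have [x px] : exists x, 0 < cpow p l x.
  apply: contrapT => /forallNP h.
  have : mass (cpow p l) = 0.
    apply: esum1 => x _; apply/eqP; rewrite eq_le cpow_ge0// andbT.
    by rewrite leNgt; apply/negP; exact: h.
  by rewrite cpow_mass1// => /eqP; rewrite onee_eq0.
rewrite mul2n -addnn -(mulgV x); apply: lt_le_trans (cpow_ge l l x x^-1 p0).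
by rewrite -sym_cpow// mule_gt0.
Qed.

(** The free parameter l allows two elements to be reached at a common even
    time. *)
Lemma cpow_sqr_gt0 i l g : 0 < cpow p i g -> 0 < cpow p (2 * (i + l)) (g * g)%g.
Proof.
move=> pg; rewrite mulnDr -[X in cpow _ _ X]mulg1.
apply: lt_le_trans (cpow_ge _ _ _ _ p0).
rewrite mule_gt0 ?cpow_return_gt0// mul2n -addnn.
by apply: lt_le_trans (cpow_ge i i g g p0); rewrite mule_gt0.
Qed.

Lemma generates_cpow_gt0 : generates_semigroup [set g | 0 < p g] ->
  forall g, exists n, 0 < cpow p n g.
Proof.
move=> gen_p g; have : [set: G] g by [].
rewrite -gen_p => /(_ [set g | exists n, 0 < cpow p n g]); apply.
split=> [x y [m hx] [n hy]|x px]; last by exists 1%N; rewrite cpow1.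
exists (m + n)%N; apply: lt_le_trans (cpow_ge m n x y p0).
exact: mule_gt0.
Qed.

End Positivity.

Section Quotients.
Variable G : groupType.
Implicit Types M N : normal_subgroup G.

Lemma quotient_map1P N x : quotient_map N x = 1 <-> nsubgroup N x.
Proof.
rewrite -(hom1 (quotient_map N)); split=> [/esym/quotient_mapP|Nx].
  by rewrite invg1 mul1g.
by apply/esym/quotient_mapP; rewrite invg1 mul1g.
Qed.

Lemma subset_quotient_factors M N :
  nsubgroup M `<=` nsubgroup N -> quotient_factors M N.
Proof.
move=> MN; pose f (x : quotient_group M) := quotient_map N (repr x).
have fE u : f (quotient_map M u) = quotient_map N u.
  by apply/esym/quotient_mapP/MN; exact: repr_quotient_map.
have fM : {morph f : x y / x * y}.
  move=> x y; rewrite -(quotient_mapK x) -(quotient_mapK y) -gmulfM !fE.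
  exact: gmulfM.
pose fm := isMultiplicative.Build _ _ f fM.
pose fh : {multiplicative quotient_group M -> quotient_group N} := HB.pack f fm.
by exists fh; apply/funext => u /=; rewrite -fE.
Qed.

Lemma setI_nsubgroup N (A : set G) : A 1 -> (forall x y, A x -> A y -> A (x * y)) ->
  (forall x, A x -> A x^-1) -> (forall x y, A x -> A (x ^ y)) ->
  exists P : normal_subgroup G, nsubgroup P = nsubgroup N `&` A.
Proof.
move=> A1 AM AV AJ; unshelve eexists.
  apply: (@NormalSubgroup G (nsubgroup N `&` A)).
  - by split; [exact: nsubgroup1|].
  - by move=> x y [? ?] [? ?]; split; [exact: nsubgroupM|exact: AM].
  - by move=> x [? ?]; split; [exact: nsubgroupV|exact: AV].
  - by move=> x y [? ?]; split; [exact: nsubgroupJ|exact: AJ].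
by [].
Qed.

End Quotients.

Section HeightKernel.
Variables (d : nat) (hd : (2 <= d)%N) (N : normal_subgroup (free_group d)).
Local Open Scope ring_scope.

(** For n in N with n <> 1, a commutator of n with a letter lies in N and has
    height 0, and one of them is not trivial since n is not central. *)
Lemma height_kernel : proper_quotient N ->
  exists P : normal_subgroup (free_group d),
  [/\ nsubgroup P `<=` nsubgroup N, forall x : free_group d, nsubgroup P x -> height x = 0,
      exists2 x, nsubgroup P x & x <> 1%g &
      forall x y, nsubgroup N x -> nsubgroup N y ->
        commute (quotient_map P x) (quotient_map P y)].
Proof.
move=> Np.
have hJ (x y : free_group d) : height (x ^ y)%g = height x.
  by rewrite /conjg !heightM heightV addrC addrK.
have [P PE] : exists P : normal_subgroup (free_group d),
    nsubgroup P = nsubgroup N `&` [set x : free_group d | height x = 0].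
  apply: setI_nsubgroup => [|x y hx hy|x hx|x y hx] /=.
  - exact: height1.
  - by rewrite heightM hx hy addr0.
  - by rewrite heightV hx oppr0.
  - by rewrite hJ.
exists P; rewrite PE; split.
- by move=> x [].
- by move=> x [].
- have [n Nn n1] : exists2 n, nsubgroup N n & n <> 1%g.
    apply: contrapT => h; apply: Np; apply/seteqP; split => [x Nx /=|x ->].
      by apply: contrapT => x1; apply: h; exists x.
    exact: nsubgroup1.
  have [a an] := center_trivial hd n1.
  exists (n^-1 * n ^ gen a)%g.
    split; first by apply: nsubgroupM; [exact: nsubgroupV|exact: nsubgroupJ].
    have : height (n^-1 * n ^ gen a)%g = 0 by rewrite heightM heightV hJ addNr.
    exact.
  by move/eqP; rewrite -commgEl => /commgP/esym.
- move=> x y Nx Ny; rewrite /commute -!gmulfM; apply/quotient_mapP; rewrite PE; split.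
    by apply: nsubgroupM; [apply: nsubgroupV|]; exact: nsubgroupM.
  have : height ((x * y)^-1 * (y * x))%g = 0.
    by rewrite heightM heightV !heightM [X in _ + X]addrC addNr.
  exact.
Qed.

End HeightKernel.

Section QuotientRadius.
Variables (R : realType) (G H : groupType) (pi : {multiplicative G -> H}).
Variables (p : G -> \bar R) (r : R).
Local Open Scope ring_scope.
Local Open Scope ereal_scope.
Hypotheses (p0 : ge0fun p) (ps : sym_mass p) (p1 : mass p = 1).
Hypothesis pr : is_radius (pushmass pi p) r.

(** Distinct elements of S may have the same image; the mass of the image
    counts their whole fibre. *)
Lemma le_sum_push (q : G -> \bar R) (S : seq G) : uniq S -> ge0fun q ->
  \sum_(s <- S) q s <= \sum_(y <- undup (map pi S)) pushmass pi q y.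
Proof.
move=> uS q0; pose qS x := if x \in S then q x else 0.
have qS0 : ge0fun qS by move=> x; rewrite /qS; case: ifP.
have -> : \sum_(s <- S) q s = mass qS.
  rewrite /mass (esum_supp uS)//; last by move=> x; rewrite /qS => /negbTE ->.
  by apply: eq_big_seq => s sS; rewrite /qS sS.
rewrite -(push_mass pi)// /mass (@esum_supp _ _ (undup (map pi S))) ?undup_uniq//.
- apply: lee_sum => y _; apply: le_esum => x _.
  by rewrite /qS; case: ifP.
- exact: push_ge0.
- move=> y yS; apply: esum1 => x /= xy; rewrite /qS; case: ifP => // xS.
  by move: yS; rewrite mem_undup -xy map_f.
Qed.

Lemma radius_push_commuting (S : seq G) m : uniq S ->
  {in S &, forall s t, commute (pi s) (pi t)} ->
  \sum_(s <- S) cpow p m s <= (r ^+ m)%:E.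
Proof.
move=> uS comm; apply: le_trans (le_sum_push uS (cpow_ge0 m p0)) _.
rewrite push_cpow//; apply: radius_commuting => //.
- exact: push_ge0.
- exact: push_sym.
- by rewrite push_mass.
- exact: undup_uniq.
- by move=> y z; rewrite !mem_undup => /mapP[s sS ->] /mapP[t tS ->]; exact: comm.
Qed.

Lemma radius_push_le (t : R) : is_radius p t -> (t <= r)%R.
Proof.
move=> [_ _ tmin]; have [r0 rub _] := pr; apply: tmin => // n _.
apply: le_trans (rub n); rewrite -push_cpow// -(hom1 pi).
by apply: le_push; exact: cpow_ge0.
Qed.

End QuotientRadius.

Lemma finite_subset_mass (R : realType) (G : groupType) (N : normal_subgroup G)
    (q : G -> \bar R) (c : \bar R) : ge0fun q ->
  (c < pushmass (quotient_map N) q 1)%E ->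
  exists S : seq G, [/\ uniq S, forall s, s \in S -> nsubgroup N s &
    (c < \sum_(s <- S) q s)%E].
Proof.
move=> q0 /ereal_sup_gt[_ [X [finX XN] <-]]; rewrite fsbig_finite//= => cX.
exists (finmap.enum_fset (fset_set X)); split => //; first exact: finmap.fset_uniq.
by move=> s; rewrite in_fset_set// inE => /XN /quotient_map1P.
Qed.

Theorem theorem1p4 (R : realType) (d : nat) (hd : (2 <= d)%N)
    (mu : probability (free_group d) R)
    (mu_sym : symmetric_measure mu) (mu_nondeg : non_degenerate mu)
    (N : normal_subgroup (free_group d)) (N_proper : proper_quotient N)
    (eps : R) (eps_gt0 : (0 < eps)%R) :
  exists M : normal_subgroup (free_group d),
    quotient_factors M N /\
    (quotient_spectral_radius N mu - eps%:E < quotient_spectral_radius M mu)%E /\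
    (quotient_spectral_radius M mu < quotient_spectral_radius N mu)%E.
Proof.
pose p := pmass mu.
have p0 : ge0fun p by exact: pmass_ge0.
have p1 : mass p = 1%E by exact: mass_pmass.
have ps : sym_mass p by exact: mu_sym.
have ppos := generates_cpow_gt0 p0 mu_nondeg.
have [P [PN P_height P_neq1 P_comm]] := height_kernel hd N_proper.
have [rN rNE rNP] := quotient_radius mu N.
have [rP rPE rPP] := quotient_radius mu P.
have rP_gt0 : (0 < rP)%R.
  apply: radius_gt0 rPP; [exact: push_ge0|exact: push_sym|by rewrite push_mass].
(* N / P is abelian, so every finite part of N commutes modulo P. *)
have NP : (rN <= rP)%R.
  have [_ _ rNmin] := rNP; apply: rNmin; first exact: ltW.
  move=> n _; rewrite leNgt; apply/negP.
  rewrite -push_cpow// => /(finite_subset_mass (cpow_ge0 _ p0))[S [uS SN]].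
  rewrite ltNge => /negP; apply.
  apply: (radius_push_commuting p0 ps p1 rPP) => //.
  by move=> s t sS tS; apply: P_comm; exact: SN.
(* The maximum with 0 keeps powers monotone when eps exceeds the radius. *)
have tP : (Num.max 0 (rP - eps) < rP)%R by rewrite gt_max rP_gt0; lra.
have [n [n0 hn]] : exists n, (0 < n)%N /\
    ((Num.max 0 (rP - eps) ^+ (2 * n))%:E < cpow (pushmass (quotient_map P) p) (2 * n) 1)%E.
  apply: contrapT => h; have [_ _ rPmin] := rPP.
  have : (rP <= Num.max 0 (rP - eps))%R.
    apply: rPmin; first by rewrite le_max lexx.
    by move=> n n0; rewrite leNgt; apply/negP => hn; apply: h; exists n.
  by rewrite leNgt tP.
move: hn; rewrite -push_cpow// => /(finite_subset_mass (cpow_ge0 _ p0))[S [uS SP hS]].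
have [M [MP M_comm [a [b [E [Pa Pb Ea Eb]]]]]] :=
  exists_intermediate hd P_height P_neq1 SP.
have [rM rME rMP] := quotient_radius mu M.
have MN : nsubgroup M `<=` nsubgroup N by move=> x /MP/PN.
exists M; split; first exact: subset_quotient_factors.
have [f fE] := subset_quotient_factors MP.
have [g gE] := subset_quotient_factors PN.
have pM0 : ge0fun (pushmass (quotient_map M) p) by exact: push_ge0.
have pP0 : ge0fun (pushmass (quotient_map P) p) by exact: push_ge0.
have pME : pushmass (quotient_map P) p = pushmass f (pushmass (quotient_map M) p).
  by rewrite -push_comp// -fE.
have pPE : pushmass (quotient_map N) p = pushmass g (pushmass (quotient_map P) p).
  by rewrite -push_comp// -gE.
have PN_le : (rP <= rN)%R.
  move: rNP; rewrite -/p pPE => rNP'; exact: radius_push_le pP0 rNP' _ rPP.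
have M_gt : (rP - eps < rM)%R.
  have [rM0 _ _] := rMP.
  have := lt_le_trans hS (radius_push_commuting p0 ps p1 rMP (2 * n) uS M_comm).
  rewrite lte_fin ltr_pXn2r ?nnegrE ?le_max ?lexx ?muln_gt0//.
  by rewrite gt_max => /andP[].
have M_lt : (rM < rP)%R.
  have [i pa] := ppos a; have [j pj] := ppos b.
  have push_gt0 m u : (0 < cpow p m u)%E ->
      (0 < cpow (pushmass (quotient_map M) p) m (quotient_map M u))%E.
    move=> pu; rewrite -push_cpow//; apply: lt_le_trans pu _.
    by apply: le_push; exact: cpow_ge0.
  have fa u : nsubgroup P u -> f (quotient_map M u) = 1.
    by move=> /quotient_map1P; rewrite fE.
  rewrite -/p pME in rPP.
  apply: (@radius_strict R _ _ f (pushmass (quotient_map M) p) pM0 _ _ _ rP E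
    (quotient_map M (a * a)) (quotient_map M (b * b)) (i + j.+1) rPP) => //.
  - exact: push_sym.
  - by rewrite push_mass.
  - move=> y; have [m hm] := ppos (repr y); exists m.
    rewrite -pME -push_cpow// -[y]quotient_mapK; apply: lt_le_trans hm _.
    by apply: le_push; exact: cpow_ge0.
  - by apply: fa; exact: nsubgroupM.
  - by apply: fa; exact: nsubgroupM.
  - by apply: push_gt0; exact: cpow_sqr_gt0.
  - by apply: push_gt0; rewrite addnS -addSn addnC; exact: cpow_sqr_gt0.
  - by rewrite addnS.
rewrite rNE rME -EFinB !lte_fin; split; last exact: lt_le_trans M_lt PN_le.
by apply: le_lt_trans M_gt; rewrite lerB.
Qed.
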